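(* Let $p$ be a prime and let $G, H$ be countably based abelian dual-reduced pro-$p$ groups with the same torsion sequence, i.e. $G$ and $H$ have the same torsion type $\tau$ and $G_{T_\alpha}\cong H_{T_\alpha}$ as topological groups for each ordinal $\alpha<\tau$. Then $G$ and $H$ are isomorphic as topological groups.
   Context: A profinite group is countably based if its identity has a countable neighbourhood basis (equivalently, it has only countably many open normal subgroups). For an abelian group $A$, $t(A)$ denotes the subgroup of torsion elements; an overline denotes topological closure. A profinite group is dual-reduced if it has no non-trivial continuous torsion-free quotient (i.e. no non-trivial torsion-free quotient by a closed normal subgroup). Torsion series: for an abelian pro-$p$ group $G$, define closed subgroups $T_\alpha(G)$ by transfinite recursion: $T_0(G)$ is trivial; $T_{\alpha+1}(G)\supseteq T_\alpha(G)$ is the subgroup with $T_{\alpha+1}(G)/T_\alpha(G)=\overline{t(G/T_\alpha(G))}$; and $T_\delta(G)=\overline{\langle T_\alpha(G):\alpha<\delta\rangle}$ for $\delta$ a limit ordinal. The torsion type of $G$ is the least ordinal $\tau$ with $T_\tau(G)=T_{\tau+1}(G)$. Put $G_{T_\alpha}=T_{\alpha+1}(G)/T_\alpha(G)$. The torsion sequence of $G$ is the transfinite sequence $(G_{T_\alpha})_{\alpha<\tau}$. *)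

(* Defs.v *)
From HB Require Import structures.
From mathcomp Require Import all_boot all_order all_algebra.
From mathcomp Require Import all_classical all_reals all_analysis.

Set Implicit Arguments.
Unset Strict Implicit.
Unset Printing Implicit Defensive.

Import GRing.Theory.
Local Open Scope classical_set_scope.
Local Open Scope ring_scope.
Local Open Scope quotient_scope.

Section Subgroups.
Variable G : topologicalZmodType.

Definition trivial_subgroup : {pred G} := [pred x | x == 0].
Lemma trivial_subgroup_closed : zmod_closed trivial_subgroup.
Proof.
by split=> [|x y]; rewrite !inE // => /eqP-> /eqP->; rewrite subr0.
Qed.
HB.instance Definition _ :=
  GRing.isZmodClosed.Build G trivial_subgroup trivial_subgroup_closed.

Definition torsion_subgroup : {pred G} :=
  [pred x | `[< exists2 n, (0 < n)%N & x *+ n = 0 >] ].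
Lemma torsion_subgroup_closed : zmod_closed torsion_subgroup.
Proof.
split=> [|x y /asboolP[m m0 xm] /asboolP[n n0 yn]]; apply/asboolP.
  by exists 1%N.
exists (m * n)%N; first by rewrite muln_gt0 m0.
by rewrite mulrnBl mulrnA xm mul0rn mulnC mulrnA yn mul0rn subr0.
Qed.
HB.instance Definition _ :=
  GRing.isZmodClosed.Build G torsion_subgroup torsion_subgroup_closed.

Definition generated_subgroup (A : set G) : {pred G} :=
  [pred x | `[< forall K : zmodClosed G, A `<=` [set` K] -> x \in K >] ].
Lemma generated_subgroup_closed A : zmod_closed (generated_subgroup A).
Proof.
split=> [|x y /asboolP xA /asboolP yA]; apply/asboolP => K AK.
  exact: rpred0.
by rewrite rpredB ?xA ?yA.
Qed.
HB.instance Definition _ A := GRing.isZmodClosed.Build G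
  (generated_subgroup A) (generated_subgroup_closed A).

Definition closure_subgroup (K : zmodClosed G) : {pred G} :=
  [pred x | `[< closure [set` K] x >] ].
Lemma closure_subgroup_closed K : zmod_closed (closure_subgroup K).
Proof.
split=> [|x y /asboolP xK /asboolP yK]; apply/asboolP.
  by apply: subset_closure => /=; exact: rpred0.
move=> U Uxy.
have [[A B] /= [Ax By] ABU] := @sub_continuous G (x, y) U Uxy.
have [a [aK Aa]] := xK _ Ax; have [b [bK Bb]] := yK _ By.
exists (a - b); split; first by rewrite /= rpredB.
exact: (ABU (a, b)).
Qed.
HB.instance Definition _ K := GRing.isZmodClosed.Build G
  (closure_subgroup K) (closure_subgroup_closed K).

End Subgroups.
Arguments trivial_subgroup : clear implicits.
Arguments torsion_subgroup : clear implicits.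

Section Preimage.
Variables (G H : zmodType) (f : {additive G -> H}) (K : zmodClosed H).

Definition preimage_subgroup : {pred G} := [pred x | f x \in K].
Lemma preimage_subgroup_closed : zmod_closed preimage_subgroup.
Proof.
split=> [|x y]; rewrite !inE; first by rewrite raddf0 rpred0.
by move=> xK yK; rewrite raddfB rpredB.
Qed.
HB.instance Definition _ :=
  GRing.isZmodClosed.Build G preimage_subgroup preimage_subgroup_closed.
End Preimage.

(* A subgroup as a topological group, with the subspace topology. *)
Section SubgroupType.
Variables (G : topologicalZmodType) (S : zmodClosed G).

Definition subgroup : Type :=
  initial_topology (val : {x : G | x \in S} -> G).
HB.instance Definition _ := Topological.on subgroup.
HB.instance Definition _ := SubChoice.copy subgroup {x : G | x \in S}.
HB.instance Definition _ := [SubChoice_isSubZmodule of subgroup by <:].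

Lemma subgroup_sub_continuous :
  continuous (fun x : subgroup * subgroup => x.1 - x.2).
Proof.
have cval : continuous (val : subgroup -> G).
  exact: (@initial_continuous {x : G | x \in S} G val).
have csub : continuous (fun u : subgroup * subgroup => val u.1 - val u.2).
  move=> [x y]; apply: (@continuous_comp _ _ _
    (fun u : subgroup * subgroup => (val u.1, val u.2))
    (fun u : G * G => u.1 - u.2)); last exact: sub_continuous.
  apply: cvg_pair => /=.
    by apply: cvg_comp; [exact: cvg_fst | exact: cval].
  by apply: cvg_comp; [exact: cvg_snd | exact: cval].
move=> u U [_ [[B oB <-] /= Bu sBU]].
have valB (v : subgroup * subgroup) : val (v.1 - v.2) = val v.1 - val v.2 :> G.
  exact: (raddfB (val : subgroup -> G)).
have {}Bu : B (val u.1 - val u.2) by rewrite -valB.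
have nB : nbhs (val u.1 - val u.2) B by apply: open_nbhs_nbhs.
apply: (@filterS _ (nbhs u) _ _ _ _ (csub u B nB)) => v /= Bv; apply: sBU.
by move: Bv; rewrite -valB.
Qed.
HB.instance Definition _ :=
  PreTopologicalNmodule_isTopologicalZmodule.Build subgroup
    subgroup_sub_continuous.

End SubgroupType.

(* The quotient of G by N as a topological group, with the quotient topology. *)
Section QuotientGroup.
Variables (G : topologicalZmodType) (N : zmodClosed G).

Definition quotient_group : Type := quotient_topology (Quotient.quot N).
HB.instance Definition _ := Topological.on quotient_group.
HB.instance Definition _ := GRing.isZmodule.Build quotient_group
  (@Quotient.addqA _ N) (@Quotient.addqC _ N) (@Quotient.add0q _ N)
  (@Quotient.addNq _ N).

Definition quotient_map (x : G) : quotient_group := \pi_(Quotient.quot N) x.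

Lemma quotient_map_is_zmod_morphism : zmod_morphism quotient_map.
Proof. exact: (@pi_is_zmod_morphism _ _ _ (Quotient.quot N)). Qed.
HB.instance Definition _ := GRing.isZmodMorphism.Build G quotient_group
  quotient_map quotient_map_is_zmod_morphism.

Lemma quotient_map_eqP (x y : G) :
  quotient_map x = quotient_map y <-> x - y \in N.
Proof. rewrite Quotient.idealrBE; split=> [e|/eqP/=]; [apply/eqP; exact: e|]; apply. Qed.

Lemma quotient_map_surj (a : quotient_group) : exists x, quotient_map x = a.
Proof. by exists (repr (a : Quotient.quot N)); exact: reprK. Qed.

Lemma quotient_map_continuous : continuous quotient_map.
Proof. exact: pi_continuous. Qed.

Lemma quotient_map_open (A : set G) : open A -> open (quotient_map @` A).
Proof.
move=> oA; rewrite /open /= /quotient_open.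
rewrite [X in open X](_ : _ =
    \bigcup_(n in [set` N]) ((fun x : G => x - n) @^-1` A)).
  apply: bigcup_open => n _; apply: open_comp => // x _.
  apply: (@continuous_comp _ _ _ (fun x => (x, n)) (fun u : G * G => u.1 - u.2)).
    by apply: cvg_pair => /=; [exact: cvg_id | exact: cvg_cst].
  exact: sub_continuous.
apply/seteqP; split => [x [a Aa /esym/quotient_map_eqP]|x [n /= Nn An]].
  move=> xaN; exists (x - a) => //=.
  by rewrite opprB addrC subrK.
exists (x - n) => //; apply/quotient_map_eqP.
by rewrite addrAC subrr add0r rpredN.
Qed.

Lemma quotient_sub_continuous :
  continuous (fun u : quotient_group * quotient_group => u.1 - u.2).
Proof.
move=> [a b]; have [x <-] := quotient_map_surj a.
have [y <-] := quotient_map_surj b => U /=.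
rewrite -raddfB => /quotient_map_continuous Uxy.
have [[A B] /= [Ax By] ABU] := @sub_continuous G (x, y) _ Uxy.
have [A' [oA A'x] AA'] : exists2 A', open_nbhs x A' & A' `<=` A.
  by move: Ax; rewrite nbhsE.
have [B' [oB B'y] BB'] : exists2 B', open_nbhs y B' & B' `<=` B.
  by move: By; rewrite nbhsE.
suff : nbhs (quotient_map x, quotient_map y)
    ((fun u : quotient_group * quotient_group => u.1 - u.2) @^-1` U) by [].
exists (quotient_map @` A', quotient_map @` B') => /=.
  by split; apply: open_nbhs_nbhs; split;
    [exact: quotient_map_open | exists x | exact: quotient_map_open | exists y].
move=> [_ _] /= [[a' Aa' <-] [b' Bb' <-]]; rewrite -raddfB.
by apply: (ABU (a', b')); split; [exact: AA' | exact: BB'].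
Qed.
HB.instance Definition _ :=
  PreTopologicalNmodule_isTopologicalZmodule.Build quotient_group
    quotient_sub_continuous.

End QuotientGroup.

(* Continuous isomorphism with continuous inverse. *)
Definition topologically_isomorphic (G H : topologicalZmodType) : Prop :=
  exists (f : {additive G -> H}) (g : H -> G),
    [/\ cancel f g, cancel g f, continuous f & continuous g].

Definition torsion_free (G : zmodType) : Prop :=
  forall (x : G) n, (0 < n)%N -> x *+ n = 0 -> x = 0.

Definition countably_based (G : topologicalZmodType) : Prop :=
  exists B : set (set G),
    [/\ countable B, forall U, B U -> nbhs (0 : G) U &
        forall V, nbhs (0 : G) V -> exists2 U, B U & U `<=` V].

Definition profinite (G : topologicalZmodType) : Prop :=
  [/\ compact [set: G], hausdorff_space G & totally_disconnected [set: G]].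

(* Every subgroup is normal, and U ranges over the open ones.                 *)
Definition pro_p (p : nat) (G : topologicalZmodType) : Prop :=
  profinite G /\
  forall U : zmodClosed G, open [set` U] ->
    exists n, ([set: quotient_group U] #= `I_(p ^ n))%card.

Definition dual_reduced (G : topologicalZmodType) : Prop :=
  forall N : zmodClosed G, closed [set` N] ->
    torsion_free (quotient_group N) -> forall x : quotient_group N, x = 0.

(* Ordinals as well-founded trees: osup f is the least ordinal strictly above *)
(* all the f i.  Distinct trees may denote the same ordinal: equality of      *)
(* ordinals is oeq, the equivalence of the total preorder ole.                *)
Inductive ordnum : Type := osup (I : Type) (f : I -> ordnum).

Fixpoint ole (a b : ordnum) : Prop :=
  match a, b with
  | osup _ f, osup _ g => forall i, exists j, ole (f i) (g j)
  end.

Definition olt (a b : ordnum) : Prop :=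
  match b with osup _ g => exists j, ole a (g j) end.

Definition oeq (a b : ordnum) : Prop := ole a b /\ ole b a.

Definition ozero : ordnum := osup (fun i : void => match i with end).

Definition osucc (a : ordnum) : ordnum := osup (fun _ : unit => a).

Definition olimit (a : ordnum) : Prop :=
  ~ oeq a ozero /\ forall b, ~ oeq a (osucc b).

Lemma ole_refl a : ole a a.
Proof. by elim: a => I f IH /= i; exists i; exact: IH. Qed.

Lemma ole_trans b a c : ole a b -> ole b c -> ole a c.
Proof.
elim: a b c => I f IH [J g] [K h] ab bc i.
have [j fg] := ab i; have [k gh] := bc j.
by exists k; exact: (IH _ _ _ fg gh).
Qed.

Lemma olt_le_trans b a c : olt a b -> ole b c -> olt a c.
Proof.
case: b c => [J g] [K h] /= [j aj] bc; have [k gh] := bc j.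
by exists k; exact: ole_trans aj gh.
Qed.

Lemma ole_lt_trans b a c : ole a b -> olt b c -> olt a c.
Proof. by case: c => K h ab [k bk]; exists k; exact: ole_trans ab bk. Qed.

Lemma ole_ltP a b : ole a b <-> forall c, olt c a -> olt c b.
Proof.
split=> [ab c ca|]; first exact: olt_le_trans ca ab.
case: a b => I f [J g] ab i; apply: ab; exists i; exact: ole_refl.
Qed.

Lemma olt_wf : well_founded olt.
Proof.
suff H a b : ole b a -> Acc olt b by move=> a; exact: H (ole_refl a).
elim: a b => I f IH [J g] ba; constructor=> c [j cg].
by have [i gf] := ba j; apply: (IH i); exact: ole_trans cg gf.
Qed.

Lemma ole_total a b : ole a b \/ olt b a.
Proof.
elim: a b => I f IH b.
have [fb|/existsNP[i nfi]] := pselect (forall i, olt (f i) b).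
  by left; case: b fb.
right; exists i; apply/ole_ltP => c cb.
have [fc|//] := IH i c.
by case: nfi; exact: ole_lt_trans cb.
Qed.

Lemma olt_succ a b : olt b (osucc a) <-> ole b a.
Proof. by split=> [[]//|ba]; exists tt. Qed.

Lemma oeq_sym a b : oeq a b -> oeq b a.
Proof. by case. Qed.

Lemma oeq_trans b a c : oeq a b -> oeq b c -> oeq a c.
Proof.
by move=> [ab ba] [bc cb]; split; [exact: ole_trans bc | exact: ole_trans ba].
Qed.

Lemma osucc_inj a b : oeq (osucc a) (osucc b) -> oeq a b.
Proof. by move=> [/(_ tt)[_ ab] /(_ tt)[_ ba]]. Qed.

Lemma osucc_neq0 a : ~ oeq (osucc a) ozero.
Proof. by move=> [/(_ tt)[]]. Qed.

Section TorsionSeries.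
Variable G : topologicalZmodType.

(* The subgroup S containing K with S / K the closure of the torsion subgroup *)
(* of G / K.                                                                  *)
Definition torsion_step (K : zmodClosed G) : zmodClosed G :=
  preimage_subgroup (@quotient_map G K)
    (closure_subgroup (torsion_subgroup (quotient_group K))).

Definition torsion_body (a : ordnum)
    (rec : forall b, olt b a -> zmodClosed G) : zmodClosed G :=
  if pselect (oeq a ozero) then trivial_subgroup G : zmodClosed G
  else match pselect (exists b, oeq a (osucc b)) return zmodClosed G with
  | left succ_a =>
      let: exist b ab := cid succ_a in
      torsion_step (rec b (olt_le_trans (proj2 (olt_succ b b) (ole_refl b))
                                        (proj2 ab)))
  | right _ =>
      closure_subgroup (generated_subgroup
        [set x | exists b (ba : olt b a), x \in rec b ba])
  end.

(* The series T_a(G), by well-founded recursion on a; its defining equations  *)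
(* are torsion_series0, torsion_seriesS and torsion_series_lim.               *)
Definition torsion_series : ordnum -> zmodClosed G :=
  Fix olt_wf (fun _ => zmodClosed G) torsion_body.

Lemma torsion_seriesE a :
  torsion_series a = @torsion_body a (fun b _ => torsion_series b).
Proof.
rewrite /torsion_series Fix_eq // => b f g fg.
by congr torsion_body; apply/functional_extensionality_dep => c; apply/funext.
Qed.

Lemma torsion_series_oeq a b : oeq a b -> torsion_series a = torsion_series b.
Proof.
elim/(well_founded_ind olt_wf): a b => a IH b ab.
rewrite !torsion_seriesE /torsion_body.
case: (pselect (oeq a _)) => [a0|na0];
  case: (pselect (oeq b _)) => [b0|nb0] //=.
- by case: nb0; exact: oeq_trans (oeq_sym ab) a0.
- by case: na0; exact: oeq_trans ab b0.
case: (pselect (exists c, oeq a _)) => [sa|nsa];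
  case: (pselect (exists c, oeq b _)) => [sb|nsb] //=.
- case: (cid sa) (cid sb) => [c ac] [d bd]; congr torsion_step.
  apply: IH; first by apply: olt_le_trans (proj2 ac); exists tt; exact: ole_refl.
  exact: osucc_inj (oeq_trans (oeq_trans (oeq_sym ac) ab) bd).
- by case: nsb; have [c ac] := sa; exists c; exact: oeq_trans (oeq_sym ab) ac.
- by case: nsa; have [c bc] := sb; exists c; exact: oeq_trans ab bc.
congr (closure_subgroup (generated_subgroup _) : zmodClosed G).
apply/seteqP; split=> x [c [ca xc]]; exists c; exists => //.
  exact: olt_le_trans ca ab.1.
exact: olt_le_trans ca ab.2.
Qed.

Lemma torsion_series0 : torsion_series ozero = trivial_subgroup G.
Proof.
rewrite torsion_seriesE /torsion_body; case: pselect => // -[].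
by split; exact: ole_refl.
Qed.

Lemma torsion_seriesS a :
  torsion_series (osucc a) = torsion_step (torsion_series a).
Proof.
rewrite torsion_seriesE /torsion_body.
case: pselect => [/osucc_neq0//|_] /=; case: pselect => [sa|[]]; last first.
  by exists a; split; exact: ole_refl.
by case: (cid sa) => b /osucc_inj/torsion_series_oeq ->.
Qed.

Lemma torsion_series_lim a : olimit a ->
  torsion_series a = closure_subgroup (generated_subgroup
    [set x | exists2 b, olt b a & x \in torsion_series b]).
Proof.
move=> [na0 nsa]; rewrite torsion_seriesE /torsion_body.
case: pselect => //= _; case: pselect => [[b /nsa]//|_].
congr (closure_subgroup (generated_subgroup _) : zmodClosed G).
by apply/seteqP; split=> x [b]; [case | ]; exists b.
Qed.

Lemma torsion_step_sub (K : zmodClosed G) x : x \in K -> x \in torsion_step K.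
Proof.
move=> xK; apply/asboolP; apply: (@subset_closure (quotient_group K)) => /=.
have -> : quotient_map K x = 0.
  by rewrite -(raddf0 (@quotient_map G K)); apply/quotient_map_eqP; rewrite subr0.
exact: rpred0.
Qed.

Lemma torsion_series_le (a b : ordnum) x : ole a b ->
  x \in torsion_series a -> x \in torsion_series b.
Proof.
elim/(well_founded_ind olt_wf): b a x => b IH a x ab xa.
have [ba|nba] := pselect (ole b a).
  by rewrite -(torsion_series_oeq (conj ab ba)).
have ltab : olt a b by have [//|] := ole_total b a.
have [[c bc]|nsb] := pselect (exists c, oeq b (osucc c)).
  rewrite (torsion_series_oeq bc) torsion_seriesS.
  apply/torsion_step_sub; apply: (IH c _ a) => //.
    by apply: olt_le_trans bc.2; exists tt; exact: ole_refl.
  by apply/olt_succ; exact: olt_le_trans bc.1.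
have lb : olimit b.
  split=> [b0|c bc]; last by apply: nsb; exists c.
  by have [] := olt_le_trans ltab b0.1.
rewrite torsion_series_lim //; apply/asboolP; apply: subset_closure.
by apply/asboolP => K; apply; exists a.
Qed.

Definition torsion_type (t : ordnum) : Prop :=
  torsion_series t =i torsion_series (osucc t) /\
  forall s, torsion_series s =i torsion_series (osucc s) -> ole t s.

Lemma torsion_type_exists : exists t, torsion_type t.
Proof.
have [s0 fs0] : exists s, torsion_series s =i torsion_series (osucc s).
  pose I := {S : G -> bool | exists a, S = fun x => x \in torsion_series a}.
  pose f (i : I) := sval (cid (svalP i)).
  have fP (i : I) : sval i = fun x => x \in torsion_series (f i).
    by rewrite /f; case: cid.
  pose t := osup f.
  have tI : exists a, (fun x => x \in torsion_series t) =
    (fun x => x \in torsion_series a) by exists t.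
  pose i : I := exist _ _ tI.
  have e : torsion_series (f i) =i torsion_series t.
    by move=> x; have /= := congr1 (fun S => S x) (fP i).
  exists (f i) => x; apply/idP/idP; first by rewrite torsion_seriesS; exact: torsion_step_sub.
  rewrite e; apply: torsion_series_le => /= _; exists i; exact: ole_refl.
elim/(well_founded_ind olt_wf): s0 fs0 => s IH fs.
have [[r rs fr]|n] :=
  pselect (exists2 r, olt r s & torsion_series r =i torsion_series (osucc r)).
  exact: IH fr.
exists s; split=> // r fr; have [//|rs] := ole_total s r.
by case: n; exists r.
Qed.

(* T_(a+1)(G) / T_a(G) *)
Definition torsion_factor (a : ordnum) : topologicalZmodType :=
  quotient_group (preimage_subgroup
    (val : subgroup (torsion_series (osucc a)) -> G) (torsion_series a)).

End TorsionSeries.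

Definition same_torsion_sequence (G H : topologicalZmodType) : Prop :=
  exists t, [/\ torsion_type G t, torsion_type H t &
    forall a, olt a t ->
      topologically_isomorphic (torsion_factor G a) (torsion_factor H a)].

(* Main.v *)
From HB Require Import structures.
Require Import Defs.
From mathcomp Require Import all_boot all_order all_algebra.
From mathcomp Require Import all_classical all_reals all_analysis.
From mathcomp Require Import finmap ring.

(* Pontryagin duality turns the theorem into Ulm's theorem.  The characters   *)
(* G -> Q/Z form a countable abelian p-group A, and the characters vanishing  *)
(* on T_a(G) form p^(omega a) A: a character chi killing the n-torsion of     *)
(* G/K factors through multiplication by n and hence, extending from n(G/K),  *)
(* is n times a character.  Dual-reducedness says T_tau(G) = G, so that each  *)
(* nonzero character has a height (a, n), being in p^n (p^(omega a) A) but    *)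
(* not in p^(n+1) (p^(omega a) A).  The torsion factors determine the         *)
(* Ulm-Kaplansky invariants of A, and Mackey's back-and-forth argument builds *)
(* an isomorphism of the character groups as an increasing union of finite    *)
(* height-preserving correspondences.  Finally g in G is matched with the     *)
(* h in H at which corresponding characters take the same values; h exists by *)
(* compactness of H and is unique since characters separate points.           *)

Set Implicit Arguments.
Unset Strict Implicit.
Unset Printing Implicit Defensive.

Import GRing.Theory Num.Theory.
Local Open Scope classical_set_scope.
Local Open Scope ring_scope.

(** * Ulm's theorem *)

(** The duality argument rests on four results. First, [annihilator_torsion_step] and
    [annihilator_torsion_series_lim] identify the annihilators of the torsion series with the Ulm
    subgroups of the character group; with [dual_reduced_torsion_type] this gives every nonzero
    character a height ([dual_ulm_filtration]).

    Second, the quotient of consecutive annihilators is the dual of a torsion factor, so isomorphic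
    factors give corresponding quotients ([transport_character], [corresponding_annihilator]), and
    these quotients already determine the Ulm-Kaplansky invariants ([socle_transfer]).

    Third, [ulm_correspondence] proves Ulm's theorem for countable p-groups. The key is
    [finite_height_iso_step]: a finite height-preserving correspondence extends to any [x] with
    [p x] in its domain, and equality of invariants provides the partner of [x].

    Fourth, [topologically_isomorphic_dual] recovers the groups from their characters. Partial
    homomorphisms and isomorphisms are represented throughout by subgroups of a product, that is by
    their graphs, so extending one means adjoining a pair. *)

Lemma subrB_interchange (V : zmodType) (a b c d : V) :
  a - b - (c - d) = a - c - (b - d).
Proof. by rewrite !opprB addrACA [RHS]addrACA [- b - _]addrC. Qed.

Section Adjoin.
Variables (V : zmodType) (K : zmodClosed V) (v : V).

Definition adjoin : {pred V} := [pred x | `[< exists k : int,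
  x - v *~ k \in K >] ].

Lemma adjoin_closed : zmod_closed adjoin.
Proof.
split=> [|x y /asboolP[k xk] /asboolP[l yl]]; apply/asboolP.
  by exists 0; rewrite mulr0z subr0 rpred0.
by exists (k - l); rewrite mulrzBr subrB_interchange rpredB.
Qed.
HB.instance Definition _ := GRing.isZmodClosed.Build V adjoin adjoin_closed.

Lemma sub_adjoin x : x \in K -> x \in adjoin.
Proof. by move=> xK; apply/asboolP; exists 0; rewrite mulr0z subr0. Qed.

Lemma mem_adjoin : v \in adjoin.
Proof. by apply/asboolP; exists 1; rewrite mulr1z subrr rpred0. Qed.

(** Coefficients of [v] may be reduced modulo [n]. This keeps a finite [K] finite after adjunction,
    and lets a minimal [n] control which multiples of [v] fall into [K]. *)
Lemma adjoin_mulrn n x : (0 < n)%N -> v *+ n \in K -> x \in adjoin ->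
  exists2 r, (r < n)%N & x - v *+ r \in K.
Proof.
move=> n_gt0 vn /asboolP[k xk].
have n0 : n%:Z != 0 by rewrite -lt0n.
have := ltz_pmod k (_ : 0 < n%:Z :> int)%R; have := modz_ge0 k n0.
case: (k %% n)%Z (divz_eq k n) => // r kE _ /(_ n_gt0) ltr.
exists r => //; rewrite kE mulrzDr in xk.
have vq : v *~ ((k %/ n)%Z * n) \in K by rewrite mulrC mulrzA rpredMz.
by move: (rpredD xk vq); rewrite opprD addrA addrAC subrK.
Qed.

End Adjoin.

Lemma exists_maximal (T : eqType) (R : T -> T -> Prop) (D : T -> Prop)
    (s : seq T) :
  (forall x y, R x y \/ R y x) -> (forall y x z, R x y -> R y z -> R x z) ->
  (forall x, D x -> x \in s) -> (exists x, D x) ->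
  exists2 x, D x & forall y, D y -> R y x.
Proof.
move=> tot tr; elim: s D => [|a s IH] D Ds [x Dx]; first by have := Ds x Dx.
have [[y [Dy ya]]|nD] := pselect (exists y, D y /\ y <> a); last first.
  have Da y : D y -> y = a by move=> Dy; apply: contrapT => ya; apply: nD;
    exists y.
  by exists x => // y /Da ->; rewrite (Da x Dx); case: (tot a a).
have [|z [Dz za] zmax] := IH (fun y => D y /\ y <> a)
  _ (ex_intro _ y (conj Dy ya)).
  by move=> u [/Ds]; rewrite inE => /orP[/eqP|].
have zmax' u : D u -> u = a \/ R u z.
  by move=> Du; have [|/(conj Du)/zmax] := pselect (u = a); [left|right].
have [az|naz] := pselect (D a -> R a z).
  by exists z => // u Du; case: (zmax' u Du) => // ua; move: Du; rewrite ua.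
have Da : D a by apply: contrapT => nDa; apply: naz.
have za' : R z a by case: (tot z a) => // az; case: naz.
exists a => // u /zmax'[->|uz]; first by case: (tot a a).
exact: tr uz za'.
Qed.

(** Since [r] is invertible modulo [p] and [p v] lies in [K], non-membership facts about the coset
    [v + K] carry over to all the cosets [r v + K]. *)
Lemma coprime_mulrn_adjust (V : zmodType) (K : zmodClosed V) p r v e :
  prime p -> (0 < r < p)%N -> v *+ p \in K -> e \in K ->
  exists u, exists2 e', e' \in K & (v *+ r + e) *+ u = v + e'.
Proof.
move=> p_pr /andP[r0 rp] vp eK; have : coprime r p.
  by rewrite coprime_sym prime_coprime // gtnNdvd.
rewrite /coprime; case: (egcdnP p r0) => u w ur _ /eqP g1.
exists u, (v *+ p *+ w + e *+ u); first by rewrite rpredD // rpredMn.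
have vr : v *+ r *+ u = v *+ p *+ w + v.
  by rewrite -mulrnA mulnC ur g1 mulrnDr mulr1n mulnC mulrnA.
by rewrite mulrnDl vr addrAC addrC.
Qed.

(** An index stands for a height. By [ulm_height] each nonzero element has an exact one, so only 0
    lies in every [F i]. *)
Record ulm_filtration (p : nat) (A : zmodType) (I : Type) (s : I -> I)
    (F : I -> zmodClosed A) : Prop := UlmFiltration {
  ulm_succ : forall i x, x \in F (s i) <-> exists2 y, y \in F i & x = y *+ p;
  ulm_height : forall x, x != 0 -> exists2 i, x \in F i & x \notin F (s i)
}.

(** A family of [m] distinct classes in the socle of [F i] modulo [F (s i)]. The dimension of this
    space over the field with [p] elements is the Ulm-Kaplansky invariant; counting elements in
    finite families replaces linear algebra, and is enough because the back-and-forth only meets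
    finite subgroups. *)
Definition socle_independent (p : nat) (A : zmodType) (I : Type) (s : I -> I)
    (F : I -> zmodClosed A) (i : I) (T : Type) (v : T -> A) : Prop :=
  (forall k, v k \in F i /\ v k *+ p = 0) /\
  forall k l, k <> l -> v k - v l \notin F (s i).

(* Both filtrations are decreasing chains, ordered alike, in which [s i]   *)
(* immediately follows [i].                                              *)
Definition compatible_filtrations (A A' : zmodType) (I : Type) (s : I -> I)
    (F : I -> zmodClosed A) (F' : I -> zmodClosed A') : Prop :=
  forall i j, ({subset F i <= F j} /\ {subset F' i <= F' j}) \/
    ({subset F j <= F (s i)} /\ {subset F' j <= F' (s i)}).

Definition invariants_le (p : nat) (A A' : zmodType) (I : Type) (s : I -> I)
    (F : I -> zmodClosed A) (F' : I -> zmodClosed A') : Prop :=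
  forall i m (v : 'I_m -> A), socle_independent p s F i v ->
    exists v' : 'I_m -> A', socle_independent p s F' i v'.

(** * Extending a finite height-preserving correspondence *)

Section UlmStep.
Variables (p : nat) (A A' : zmodType) (I : Type) (s : I -> I).
Variables (F : I -> zmodClosed A) (F' : I -> zmodClosed A').
Hypothesis p_pr : prime p.
Hypothesis FU : ulm_filtration p s F.
Hypothesis FU' : ulm_filtration p s F'.
Hypothesis FF : compatible_filtrations s F F'.
Hypothesis inv : invariants_le p s F F'.

Let height_le x y := forall i, x \in F i -> y \in F i.

Let succ_sub i x : x \in F (s i) -> x \in F i.
Proof. by move=> /(ulm_succ FU)[y yF ->]; exact: rpredMn. Qed.

Let succ_sub' i x : x \in F' (s i) -> x \in F' i.
Proof. by move=> /(ulm_succ FU')[y yF ->]; exact: rpredMn. Qed.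

Let height_leP i x y : x \in F i -> x \notin F (s i) -> y \in F i ->
  height_le x y.
Proof.
move=> xi nxi yi j xj; have [[ij _]|[ji _]] := FF i j; first exact: ij.
by move: nxi; rewrite ji.
Qed.

Let height_le_total x y : height_le x y \/ height_le y x.
Proof.
have [->|/(ulm_height FU)[i xi nxi]] := eqVneq x 0.
  by right=> i _; exact: rpred0.
have [->|/(ulm_height FU)[j yj nyj]] := eqVneq y 0.
  by left=> k _; exact: rpred0.
have [[ij _]|[ji _]] := FF i j.
  by right; apply: height_leP yj nyj _; exact: ij.
by left; apply: height_leP xi nxi _; apply: succ_sub; exact: ji.
Qed.

Let height_le_trans y x z : height_le x y -> height_le y z -> height_le x z.
Proof. by move=> xy yz i /xy /yz. Qed.

(** Preserving heights makes [K] the graph of a bijection between finite subgroups: a nonzero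
    element, having a height, cannot be paired with 0. *)
Definition finite_height_iso (K : zmodClosed (A * A')%type) : Prop :=
  (exists g : seq (A * A'), forall e, e \in K -> e \in g) /\
  forall e, e \in K -> forall i, (e.1 \in F i) = (e.2 \in F' i).

Section Lift.
Variables (K : zmodClosed (A * A')%type) (x : A) (z : A') (i : I).
Hypothesis K_iso : finite_height_iso K.
Hypothesis xz : (x *+ p, z) \in K.
Hypothesis xi : x \in F i.
Hypothesis xK : forall e, e \in K -> x + e.1 \notin F (s i).

(* The elements of the socle lying in [K + F (s i)] are, modulo [F (s i)], *)
(* the differences [y - e] with [p y = p e]; the height-preserving [K]     *)
(* matches them on both sides, so the independent element [u] supplied by  *)
(* [x] forces one outside [K] on the other side.                           *)
Lemma socle_lift u : u \in F i -> u *+ p = 0 ->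
    (forall e, e \in K -> u + e.1 \notin F (s i)) ->
  exists w, [/\ w \in F' i, w *+ p = 0 &
    forall e, e \in K -> w + e.2 \notin F' (s i)].
Proof.
move=> ui up uK; have [[g gK] pK] := K_iso.
pose M (e : A * A') := [/\ e \in K, e.1 \in F i & e.1 *+ p \in F (s (s i))].
pose indep m (v : 'I_m -> A * A') := (forall k, M (v k)) /\
  forall k l, k <> l -> (v k).1 - (v l).1 \notin F (s i).
have bound m : (exists v, @indep m v) -> (m <= size g)%N.
  move=> [v [vM vI]]; rewrite -[m]size_enum_ord -(size_map v).
  apply: uniq_leq_size => [|_ /mapP[k _ ->]]; last by apply: gK; have [] :=
    vM k.
  rewrite map_inj_uniq ?enum_uniq // => k l kl; apply: contrapT => /vI.
  by rewrite kl subrr rpred0.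
have ex0 : exists m, `[< exists v, @indep m v >].
  by exists 0; apply/asboolP; exists (fun=> 0); split=> -[].
(* A largest family in [M] of elements incongruent modulo [F (s i)]. The differences [y l - (v l).1]
   together with [u] are [m.+1] distinct socle classes, which the invariants carry to the other
   side. *)
have [m /asboolP[v [vM vI]] mmax] := ex_maxnP ex0 (fun m h =>
  bound m (asboolW h)).
have yE k : exists y, y \in F (s i) /\ (v k).1 *+ p = y *+ p.
  by have [_ _ /(ulm_succ FU)[y yF ->]] := vM k; exists y.
have [y {yE}yP] := choice yE.
pose q (k : 'I_m.+1) := if unlift ord0 k is Some l then y l - (v l).1 else u.
have qI : socle_independent p s F i q.
  split=> [k|k l].
    rewrite /q; case: unliftP => [l _|//]; have [yl e] := yP l.
    rewrite mulrnBl e subrr rpredB //; last by have [] := vM l.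
    exact: succ_sub.
  have uv n : u - (y n - (v n).1) \notin F (s i).
    have [yn _] := yP n; have [vK _ _] := vM n.
    by rewrite opprB addrA rpredBr // uK.
  rewrite /q; case: unliftP => [k' ->|->]; case: unliftP => [l' ->|->] // kl.
  - have [yk _] := yP k'; have [yl _] := yP l'.
    rewrite subrB_interchange (rpredBl _ (rpredB yk yl)); apply: vI => kl'.
    by apply: kl; rewrite kl'.
  - by rewrite -rpredN opprB uv.
have [w [wF wI]] := inv qI.
apply: contrapT => nw.
have tP k : exists e, e \in K /\ w k + e.2 \in F' (s i).
  apply: contrapT => ne; have [wi wp] := wF k.
  apply: nw; exists (w k); split=> // e eK; apply/negP => weF.
  by apply: ne; exists e.
have [t {}tP] := choice tP.
(* If every [w k] were congruent to an element coming from [K], those elements [t k] would form a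
   family of the same kind with [m.+1] members. *)
suff : (m.+1 <= m)%N by rewrite ltnn.
apply: mmax; apply/asboolP; exists t; split=> [k|k l /wI].
  have [tK wt] := tP k; have [wi wp] := wF k.
  have ti : (t k).2 \in F' i by rewrite -(rpredDl _ wi) succ_sub'.
  split=> //; first by rewrite pK.
  have tpK : t k *+ p \in K by exact: rpredMn.
  have := pK _ tpK (s (s i)); rewrite !raddfMn /= => ->.
  by apply/(ulm_succ FU'); exists (w k + (t k).2) => //;
    rewrite mulrnDl wp add0r.
have [tk wk] := tP k; have [tl wl] := tP l.
have tkl : t k - t l \in K by exact: rpredB.
have := pK _ tkl (s i); rewrite !raddfB /= => ->; apply: contra => tt.
by have := rpredB (rpredB wk wl) tt; rewrite opprD addrACA addrK.
Qed.

(** If [p x] has height above [s i], then [x] differs from a socle element by some [y] in [F (s i)],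
    and [socle_lift] applies. Otherwise any [w] in [F' i] with [p w = z] works: were [w + e.2] in
    [F' (s i)], then [p (x + e.1)] would be higher than [p x], against the maximality assumed of
    [x]. *)
Lemma lift_element : 
    (forall e, e \in K -> x + e.1 \in F i ->
      height_le ((x + e.1) *+ p) (x *+ p)) ->
  exists w, [/\ w \in F' i, w *+ p = z & forall e, e \in K ->
    w + e.2 \notin F' (s i)].
Proof.
move=> xmax; have [_ pK] := K_iso.
have xp : x *+ p \in F (s i) by apply/(ulm_succ FU); exists x.
have [/(ulm_succ FU)[y yi yp]|nxp] := boolP (x *+ p \in F (s (s i))).
  have [||e eK|v [vi vp vK]] := @socle_lift (x - y).
  - by rewrite rpredB // succ_sub.
  - by rewrite mulrnBl yp subrr.
  - by rewrite addrAC rpredBr // xK.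
  have : z \in F' (s (s i)).
    by rewrite -(pK _ xz) /=; apply/(ulm_succ FU); exists y.
  move=> /(ulm_succ FU')[y' yi' ->]; exists (y' + v); split.
  - by rewrite rpredD // succ_sub'.
  - by rewrite mulrnDl vp addr0.
  - by move=> e eK; rewrite -addrA rpredDl // vK.
have : z \in F' (s i) by rewrite -(pK _ xz).
move=> /(ulm_succ FU')[w wi zw]; exists w; split=> // e eK; apply/negP => we.
have ei : e.1 \in F i by rewrite (pK _ eK) -(rpredDl _ wi) succ_sub'.
have xeK : (x *+ p, z) + e *+ p \in K by rewrite rpredD ?rpredMn.
have : (x + e.1) *+ p \in F (s (s i)).
  have := pK _ xeK (s (s i)); rewrite /= !raddfMn /= zw -!mulrnDl => ->.
  by apply/(ulm_succ FU'); exists (w + e.2).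
by move/(xmax _ eK (rpredD xi ei)); rewrite (negPf nxp).
Qed.

(** Both [x] and [w] have height exactly [i] and cannot gain height by adding elements of [K]. At
    indices up to [i] the new generator is therefore invisible; beyond [i] no element outside [K]
    survives, as one of its multiples is the generator plus an element of [K]. *)
Lemma finite_height_iso_adjoin w : w \in F' i -> w *+ p = z ->
    (forall e, e \in K -> w + e.2 \notin F' (s i)) ->
  finite_height_iso (adjoin K (x, w)).
Proof.
move=> wi wp wK; have [[g gK] pK] := K_iso.
have vp : (x, w) *+ p \in K by rewrite [_ *+ _]surjective_pairing !raddfMn /=
  wp.
have p_gt0 := prime_gt0 p_pr.
split.
  exists [seq e + (x, w) *+ r | e <- g, r <- iota 0 p] => e.
  move=> /(adjoin_mulrn p_gt0 vp)[r rp /gK er]; apply/allpairsP.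
  by exists (e - (x, w) *+ r, r); rewrite mem_iota subrK.
move=> e /(adjoin_mulrn p_gt0 vp)[[|r] rp er] j.
  by move: er; rewrite mulr0n subr0 => /pK.
set v := (x, w) *+ r.+1 in er.
have -> : e = v + (e - v) by rewrite addrC subrK.
move: (e - v) er => {}e er.
have [u [e' e'K]] := @coprime_mulrn_adjust _ K p r.+1 (x, w) e p_pr rp vp er.
rewrite -/v => veu; have v1 : v.1 = x *+ r.+1 by rewrite raddfMn.
have v2 : v.2 = w *+ r.+1 by rewrite raddfMn.
have [[ij ij']|[ji ji']] := FF i j.
  have a : v.1 \in F j by rewrite v1 rpredMn ?ij.
  have b : v.2 \in F' j by rewrite v2 rpredMn ?ij'.
  by rewrite /= (rpredDl _ a) (rpredDl _ b) pK.
apply/idP/idP => [/ji ve|/ji' ve].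
  have := xK e'K; have /= <- := congr1 fst veu.
  by rewrite raddfMn rpredMn.
have := wK _ e'K; have /= <- := congr1 snd veu.
by rewrite raddfMn rpredMn.
Qed.

End Lift.

Lemma finite_height_iso_step (K : zmodClosed (A * A')%type) x z :
    finite_height_iso K -> (x *+ p, z) \in K ->
  exists K' : zmodClosed (A * A')%type, [/\ finite_height_iso K',
    {subset K <= K'} & exists y, (x, y) \in K'].
Proof.
move=> K_iso xz; have [[y xy]|nx] := pselect (exists y, (x, y) \in K).
  by exists K; split=> //; exists y.
have [[g gK] pK] := K_iso.
(* [x] may be moved within its coset modulo the domain of [K], which is finite: first maximize the
   height of [x + e.1]. *)
have [e0 e0K xmax] : exists2 e, e \in K &
    forall e', e' \in K -> height_le (x + e'.1) (x + e.1).
  apply: (exists_maximal (R := fun e' e =>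
    height_le (x + e'.1) (x + e.1)) (s := g)) => //.
  - by move=> e2 e1 e3; exact: height_le_trans.
  - by exists 0; exact: rpred0.
have x0 : x + e0.1 != 0.
  apply/negP; rewrite addr_eq0 => /eqP xe; apply: nx; exists (- e0.2).
  by rewrite xe; have : - e0 \in K by rewrite rpredN.
have [i xi nxi] := ulm_height FU x0.
(* Among the representatives of that maximal height [i], now maximize the height of the multiple by
   [p], as [lift_element] requires. *)
have [e1 [e1K e1i] e1max] : exists2 e, e \in K /\ x + e.1 \in F i &
    forall e', e' \in K /\ x + e'.1 \in F i ->
      height_le ((x + e'.1) *+ p) ((x + e.1) *+ p).
  apply: (exists_maximal (R := fun e' e =>
    height_le ((x + e'.1) *+ p) ((x + e.1) *+ p)) (s := g)) => //.
  - by move=> e2 e1 e3; exact: height_le_trans.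
  - by move=> e [/gK].
  - by exists e0.
have x1K e : e \in K -> x + e1.1 + e.1 \notin F (s i).
  move=> eK; apply: contra nxi; rewrite -addrA; apply: (xmax (e1 + e)).
  exact: rpredD.
have xz1 : ((x + e1.1) *+ p, z + e1.2 *+ p) \in K.
  suff -> : ((x + e1.1) *+ p, z + e1.2 *+ p) = (x *+ p, z) + e1 *+ p.
    by rewrite rpredD ?rpredMn.
  by rewrite [RHS]surjective_pairing /= !raddfMn mulrnDl.
have [e eK ei|w [wi wp wK]] := lift_element K_iso xz1 e1i x1K.
  rewrite -addrA; apply: (e1max (e1 + e)); split; first exact: rpredD.
  by rewrite /= addrA.
exists (adjoin K (x + e1.1, w) : zmodClosed _); split.
- exact (finite_height_iso_adjoin K_iso xz1 e1i x1K wi wp wK).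
- by move=> e; exact: sub_adjoin.
exists (w - e1.2); suff -> : (x, w - e1.2) = (x + e1.1, w) - e1.
  by rewrite rpredB ?mem_adjoin ?sub_adjoin.
by rewrite [RHS]surjective_pairing /= addrK.
Qed.

Lemma finite_height_iso_extend (K : zmodClosed (A * A')%type) x n :
    x *+ (p ^ n) = 0 -> finite_height_iso K ->
  exists K' : zmodClosed (A * A')%type, [/\ finite_height_iso K',
    {subset K <= K'} & exists y, (x, y) \in K'].
Proof.
elim: n x K => [|n IH] x K.
  rewrite mulr1n => -> K_iso; exists K; split=> //; exists 0; exact: rpred0.
(* The element [p x] has smaller exponent, so it can be put into the domain before [x]. *)
rewrite expnS mulrnA => /IH xp /xp[K1 [K1_iso sK [z xz]]].
have [K2 [K2_iso sK2 xK2]] := finite_height_iso_step K1_iso xz.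
by exists K2; split=> // e /sK /sK2.
Qed.

End UlmStep.

Section ZeroSubgroup.
Variable V : zmodType.

Definition zero_subgroup : {pred V} := pred1 0.
Lemma zero_subgroup_closed : zmod_closed zero_subgroup.
Proof.
by split=> [|x y]; rewrite !inE // => /eqP-> /eqP->; rewrite subr0.
Qed.
HB.instance Definition _ :=
  GRing.isZmodClosed.Build V zero_subgroup zero_subgroup_closed.
End ZeroSubgroup.
Arguments zero_subgroup : clear implicits.

Section Swap.
Variables (A A' : zmodType) (K : zmodClosed (A * A')%type).

Definition swap_subgroup : {pred (A' * A)%type} := [pred e | (e.2, e.1) \in K].
Lemma swap_subgroup_closed : zmod_closed swap_subgroup.
Proof.
split=> [|x y]; rewrite !inE /=; first exact: (rpred0 K).
exact: (@rpredB _ K (x.2, x.1) (y.2, y.1)).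
Qed.
HB.instance Definition _ :=
  GRing.isZmodClosed.Build (A' * A)%type swap_subgroup swap_subgroup_closed.
End Swap.

Section ChainUnion.
Variables (V : zmodType) (K : nat -> zmodClosed V).
Hypothesis K_chain : forall n, {subset K n <= K n.+1}.

Let K_mono m n : (m <= n)%N -> {subset K m <= K n}.
Proof.
move=> /subnK <-; elim: (n - m)%N => // k IH x /IH; exact: K_chain.
Qed.

(** The proof that the [K n] increase is an argument, so that the subgroup structure can be inferred
    from the term alone. *)
Definition chain_union of (forall n, {subset K n <= K n.+1}) : {pred V} :=
  [pred x | `[< exists n, x \in K n >] ].
Lemma chain_union_closed : zmod_closed (chain_union K_chain).
Proof.
split=> [|x y /asboolP[m xm] /asboolP[n yn]]; apply/asboolP.
  by exists 0; exact: rpred0.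
exists (maxn m n); rewrite rpredB //; first exact: K_mono (leq_maxl m n) _ xm.
exact: K_mono (leq_maxr m n) _ yn.
Qed.
HB.instance Definition _ :=
  GRing.isZmodClosed.Build V (chain_union K_chain) chain_union_closed.
End ChainUnion.

Lemma finite_height_iso_swap (A A' : zmodType) (I : Type)
    (F : I -> zmodClosed A) (F' : I -> zmodClosed A') (K :
      zmodClosed (A * A')%type) :
  finite_height_iso F F' K -> finite_height_iso F' F (swap_subgroup K).
Proof.
move=> [[g gK] pK]; split=> [|e eK i]; last by rewrite -(pK _ eK).
exists [seq (e.2, e.1) | e <- g] => -[x y] xyK; apply/mapP.
by exists (y, x) => //; exact: gK.
Qed.

Theorem ulm_correspondence (p : nat) (A A' : zmodType) (I : Type) (s : I -> I)
    (F : I -> zmodClosed A) (F' : I -> zmodClosed A') (a : nat ->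
      A) (a' : nat -> A') :
  prime p -> (forall x, exists n, a n = x) -> (forall x, exists n, a' n = x) ->
  (forall x : A, exists n, x *+ (p ^ n) = 0) ->
  (forall x : A', exists n, x *+ (p ^ n) = 0) ->
  ulm_filtration p s F -> ulm_filtration p s F' ->
  compatible_filtrations s F F' ->
  invariants_le p s F F' -> invariants_le p s F' F ->
  exists K : zmodClosed (A * A')%type, [/\ forall x, exists y, (x, y) \in K,
    forall y, exists x, (x, y) \in K &
    forall x y, (x, y) \in K -> x = 0 <-> y = 0].
Proof.
move=> p_pr aP a'P pA pA' FU FU' FF inv inv'.
have FF' : compatible_filtrations s F' F.
  by move=> i j; have [[]|[]] := FF i j; [left|right].
pose T := {K : zmodClosed (A * A')%type | finite_height_iso F F' K}.
(* Back and forth: stage [n] puts [a n] into the domain, then [a' n] into the range by the same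
   extension applied to the swapped correspondence. *)
have step (nK : nat * T) : exists K' : T, [/\ {subset sval nK.2 <= sval K'},
    exists y, (a nK.1, y) \in sval K' & exists x, (x, a' nK.1) \in sval K'].
  case: nK => n [K K_iso]; have [k ak] := pA (a n); have [l al] := pA' (a' n).
  have [K1 [K1_iso sK [y xy]]] := finite_height_iso_extend p_pr FU FU' FF inv
    ak K_iso.
  have [K2 [K2_iso sK2 [x yx]]] := finite_height_iso_extend p_pr FU' FU FF'
    inv' al
    (finite_height_iso_swap K1_iso).
  exists (exist _ (swap_subgroup K2 : zmodClosed _)
    (finite_height_iso_swap K2_iso)).
  have s12 e : e \in K1 -> e \in swap_subgroup K2.
    by case: e => u v uv; apply: (sK2 (v, u)).
  split=> /= [e /sK/s12//||]; first by exists y; exact: s12.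
  by exists x.
have [f fP] := choice step.
have z_iso : finite_height_iso F F' (zero_subgroup (A * A')%type).
  split=> [|e /eqP-> i]; last by rewrite !rpred0.
  by exists [:: 0] => e; rewrite !inE.
pose K := fix K n : T :=
  if n is m.+1 then f (m, K m) else exist _ (zero_subgroup _ :
    zmodClosed _) z_iso.
have K_chain n : {subset sval (K n) <= sval (K n.+1)} by have [] := fP (n, K n).
exists (chain_union K_chain : zmodClosed _); split.
- move=> x; have [n <-] := aP x; have [_ [y xy] _] := fP (n, K n).
  by exists y; apply/asboolP; exists n.+1.
- move=> y; have [n <-] := a'P y; have [_ _ [x xy]] := fP (n, K n).
  by exists x; apply/asboolP; exists n.+1.
move=> x y /asboolP[n xyK]; have [_ pK] := svalP (K n).
have {pK} pK i : (x \in F i) = (y \in F' i) by exact: pK xyK i.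
split=> [x0|y0]; apply: contrapT => /eqP.
  by move=> /(ulm_height FU')[i _]; rewrite -pK x0 rpred0.
by move=> /(ulm_height FU)[i _]; rewrite pK y0 rpred0.
Qed.

(** * Q/Z and extension of homomorphisms *)

Definition rat_int : {pred rat} := [pred q | q \is a Num.int].
Lemma rat_int_closed : zmod_closed rat_int.
Proof. by split=> [|x y]; rewrite !inE ?rpred0 // => *; rewrite rpredB. Qed.
HB.instance Definition _ := GRing.isZmodClosed.Build rat rat_int rat_int_closed.

Definition QZ : zmodType := Quotient.quot rat_int.
Definition qz : rat -> QZ := \pi_(Quotient.quot rat_int)%qT.

Lemma qz_is_zmod_morphism : zmod_morphism qz.
Proof. exact: pi_is_zmod_morphism. Qed.
HB.instance Definition _ := GRing.isZmodMorphism.Build rat QZ qz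
  qz_is_zmod_morphism.

Lemma qz_eq0 q : (qz q == 0) = (q \is a Num.int).
Proof.
rewrite -(raddf0 qz); have := Quotient.idealrBE rat_int q 0.
by rewrite subr0 => ->; apply/idP/idP.
Qed.

Definition qz_repr (d : QZ) : rat := repr (d : Quotient.quot rat_int).
Lemma qz_reprK : cancel qz_repr qz.
Proof. by move=> d; exact: reprK. Qed.

Lemma qz_divisible n (d : QZ) : (0 < n)%N -> exists e : QZ, e *+ n = d.
Proof.
move=> n0; exists (qz (qz_repr d / n%:R)); rewrite -raddfMn /= -[RHS]qz_reprK.
by rewrite -[X in qz X]mulr_natr divfK // pnatr_eq0 -lt0n.
Qed.


Lemma qz_torsionE n (x : QZ) : (0 < n)%N -> x *+ n = 0 ->
  exists a : int, x = qz (a%:~R / n%:R).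
Proof.
move=> n0; rewrite -[x]qz_reprK -raddfMn /= => /eqP;
  rewrite qz_eq0 => /intrP[a ax].
exists a; congr qz; rewrite -ax -[X in X / _]mulr_natr mulfK //.
by rewrite pnatr_eq0 -lt0n.
Qed.

Lemma qz_frac_eq0 n (a : int) : (0 < n)%N ->
  (qz (a%:~R / n%:R) == 0) = (n %| a)%Z.
Proof.
move=> n0; have nz : (n%:R : rat) != 0 by rewrite pnatr_eq0 -lt0n.
rewrite qz_eq0; apply/intrP/dvdzP => -[q aq]; exists q.
  by apply: (@intr_inj rat); rewrite intrM -aq -pmulrn divfK.
by rewrite aq intrM -pmulrn mulfK.
Qed.

Lemma qz_order p : (1 < p)%N -> exists2 c : QZ, c != 0 & c *+ p = 0.
Proof.
move=> p1; have p0 := ltnW p1; exists (qz (1%:~R / p%:R)).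
  by rewrite qz_frac_eq0 // dvdz1 /= gtn_eqF.
rewrite -raddfMn /= -[X in qz X]mulr_natr divfK ?pnatr_eq0 -?lt0n //.
by apply/eqP; rewrite qz_eq0 rpred1.
Qed.

(** The [p ^ n.+1]-torsion of Q/Z is cyclic, and an element of exact order [p ^ n.+1] generates it:
    its numerator is prime to [p], so Bezout inverts it. *)
Lemma qz_torsion_cyclic p n (x y : QZ) : prime p ->
  x *+ p ^ n.+1 = 0 -> x *+ p ^ n != 0 -> y *+ p ^ n.+1 = 0 ->
  exists k : int, y = x *~ k.
Proof.
move=> p_pr; have p0 := prime_gt0 p_pr.
have pn0 : (0 < p ^ n.+1)%N by rewrite expn_gt0 p0.
move=> /(qz_torsionE pn0)[a ->] nx /(qz_torsionE pn0)[b ->].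
have fracMn (c : int) m : qz (c%:~R / (p ^ n.+1)%:R) *+ m =
    qz ((c * m)%:~R / (p ^ n.+1)%:R).
  by rewrite -raddfMn /= -[X in qz X]mulr_natr mulrAC intrM -pmulrn.
have pa : ~~ (p %| `|a|)%N.
  apply: contra nx => pa; rewrite fracMn qz_frac_eq0 // dvdzE abszM /=.
  by rewrite expnS dvdn_mul.
have /coprimezP[[u v] /= uv] : coprimez (p ^ n.+1)%N a.
  by rewrite coprimezE /= coprimeXl // prime_coprime.
exists (b * v); apply/eqP; rewrite -subr_eq0 -raddfMz -raddfB /=.
rewrite -[X in _ - X]mulrzr mulrAC -mulrBl -intrM -intrB qz_frac_eq0 //.
have -> : b - a * (b * v) = b * u * (p ^ n.+1)%N.
  by rewrite -[X in X - _]mulr1 -uv mulrDr; ring.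
exact: dvdz_mull.
Qed.

Section Extension.
Variable G : zmodType.
Implicit Types R : zmodClosed (G * QZ)%type.

(* A partial homomorphism from [G] to [QZ] is given by its graph. *)
Definition single_valued R : Prop := forall d, (0, d) \in R -> d = 0.

Lemma single_valued_extend R r n d : single_valued R -> (0 < n)%N ->
    (r *+ n, d) \in R ->
  exists R' : zmodClosed (G * QZ)%type,
    [/\ single_valued R', {subset R <= R'} & exists e, (r, e) \in R'].
Proof.
move=> Rs n0 rn.
have ex : exists m, (0 < m)%N && `[< exists d, (r *+ m, d) \in R >].
  by exists n; rewrite n0; apply/asboolP; exists d.
(* With [m] the least positive multiplier bringing [r] into the domain, the only constraint on the
   value [e] at [r] is [m e = c], solvable as Q/Z is divisible. *)
have [m /andP[m0 /asboolP[c rm]] mmin] := ex_minnP ex.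
have [e ec] := qz_divisible c m0.
have rem : (r, e) *+ m \in R.
  by rewrite [_ *+ _]surjective_pairing !raddfMn /= ec.
exists (adjoin R (r, e) : zmodClosed _); split.
- move=> d' /(adjoin_mulrn m0 rem)[[|k] km]; rewrite ?mulr0n ?subr0;
    first exact: Rs.
  rewrite -rpredN opprB => kR; suff : (m <= k.+1)%N by rewrite leqNgt km.
  apply: mmin; apply/asboolP; exists (e *+ k.+1 - d').
  by move: kR; rewrite [_ - _]surjective_pairing !raddfB !raddfMn /= subr0.
- by move=> x; exact: sub_adjoin.
by exists e; exact: mem_adjoin.
Qed.

Lemma single_valued_extend_seq R (rs : seq G) : single_valued R ->
    (forall x, exists n d, (0 < n)%N /\ (x *+ n, d) \in R) ->
  exists R' : zmodClosed (G * QZ)%type, [/\ single_valued R', {subset R <= R'} &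
    forall r, r \in rs -> exists e, (r, e) \in R'].
Proof.
elim: rs R => [|r rs IH] R Rs tor.
  by exists R; split.
have [n [d [n0 rn]]] := tor r.
have [R1 [R1s sR rR1]] := single_valued_extend Rs n0 rn.
have [x|R2 [R2s sR1 rsR2]] := IH R1 R1s.
  by have [m [d' [m0 /sR xm]]] := tor x; exists m, d'.
exists R2; split=> [//|x /sR/sR1//|y]; rewrite inE => /orP[/eqP->|/rsR2//].
by have [e /sR1 re] := rR1; exists e.
Qed.

(** The list [rs] meets every coset of the domain of [R], so finitely many one-element extensions
    reach the whole group. *)
Lemma hom_extension R (rs : seq G) : single_valued R ->
    (forall x, exists n d, (0 < n)%N /\ (x *+ n, d) \in R) ->
    (forall x, exists r d, r \in rs /\ (x - r, d) \in R) ->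
  exists2 f : G -> QZ, zmod_morphism f & forall x d, (x, d) \in R -> f x = d.
Proof.
move=> Rs tor rsP; have [R' [R's sR rsR']] :=
  single_valued_extend_seq rs Rs tor.
have total x : exists d, (x, d) \in R'.
  have [r [d [/rsR'[e re] /sR xr]]] := rsP x; exists (d + e).
  have : (x - r + r, d + e) \in R' by exact: rpredD xr re.
  by rewrite subrK.
have [f fP] := choice total.
have fE x d : (x, d) \in R' -> f x = d.
  move=> xd; apply/eqP; rewrite -subr_eq0; apply/eqP/R's.
  have : (x - x, f x - d) \in R' by exact: rpredB (fP x) xd.
  by rewrite subrr.
exists f => [x y|x d /sR/fE//]; apply: fE; exact: rpredB (fP x) (fP y).
Qed.

End Extension.

(** * Open subgroups of profinite groups *)

Section ZeroDimensional.
Variable T : topologicalType.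
Hypotheses (cptT : compact [set: T]) (hT : hausdorff_space T).

Let quasi_component (x : T) : set T := [set z | forall C, clopen C -> C x ->
  C z].

(** Outside [O] every point is excluded by a clopen neighbourhood of [x]; by compactness one such
    clopen set excludes them all. *)
Let quasi_component_clopen x (O : set T) : open O -> quasi_component x `<=` O ->
  exists C, [/\ clopen C, C x & C `<=` O].
Proof.
move=> oO QO; pose F := filter_from [set D : set T | D x /\ clopen D] id.
have FF : Filter F.
  apply: filter_from_filter; first by exists setT; split => //; exact: clopenT.
  by move=> A B [? ?] [? ?]; exists (A `&` B) => //; split=> //; exact: clopenI.
have PF : ProperFilter F by apply: filter_from_proper; move=> ? [? _]; exists x.
have /(iffLR (compact_near_coveringP _)) : compact (~` O).
  by apply: (subclosed_compact _ cptT) => //; exact: open_closedC.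
move=> /(_ _ _ setC (powerset_filter_from_filter PF))[].
  move=> y nOy; have /existsNP[C /not_implyP[[oC cC] /not_implyP[Cx Cy]]] :
    ~ quasi_component x y by move=> /QO.
  exists (~` C, [set U | U `<=` C]); first split.
  - by apply: open_nbhs_nbhs; split => //; exact: closed_openC.
  - apply/near_powerset_filter_fromP; first by move=> ? ?; exact: subset_trans.
    by exists C => //; exists C.
  - by case=> i j [? /subsetC]; apply.
move=> D [DF _ [C DC]]/(_ _ DC) OC; have [C' [C'x cC'] sC'] := DF _ DC.
by exists C'; split=> // z /sC' Cz; apply: contrapT => /OC.
Qed.

(** Normality separates [A] from [B]. A clopen [D] around [x] inside the union of the two separating
    open sets is cut by them into clopen pieces; the piece containing [x] contains the whole
    quasi-component, so [B] is empty. *)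
Let quasi_component_split x (A B : set T) : closed A -> closed B ->
  A `&` B = set0 -> A `|` B = quasi_component x -> A x -> B = set0.
Proof.
move=> cA cB AB ABQ Ax; have nAB : set_nbhs A (~` B).
  apply/set_nbhsP; exists (~` B); split=> //; first exact: closed_openC.
  exact/disjoints_subset.
have [C /set_nbhsP[W [oO sAO sOC]] CB] := compact_normal hT cptT cA nAB.
pose V := ~` closure C; have oV : open V by apply/closed_openC/closed_closure.
have [||D [[oD cD] Dx DOV]] := @quasi_component_clopen x (W `|` V).
- exact: openU.
- by move=> z; rewrite -ABQ => -[/sAO Oz|Bz]; [left|right=> /CB].
have DO : D `&` W = D `&` closure C.
  apply/seteqP; split=> z [Dz]; first by move=> /sOC/subset_closure.
  by move=> Cz; split=> //; have [//|] := DOV z Dz.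
have cDO : clopen (D `&` W).
  split; first exact: openI.
  by rewrite DO; apply: closedI => //; exact: closed_closure.
apply/seteqP; split=> // z Bz.
have : quasi_component x z by rewrite -ABQ; right.
by move=> /(_ _ cDO (conj Dx (sAO _ Ax)))[_ /sOC/subset_closure/CB].
Qed.

(** In a compact Hausdorff space quasi-components are connected, hence here they are points. *)
Lemma compact_zero_dimensional : totally_disconnected [set: T] ->
  zero_dimensional T.
Proof.
move=> tdT x y /eqP xy.
suff /existsNP[C /not_implyP[cC /not_implyP[Cx Cy]]] : ~ quasi_component x y.
  by exists C.
have Qx : quasi_component x x by [].
have cQ : closed (quasi_component x).
  rewrite (_ : quasi_component x = \bigcap_(C in [set C | clopen C /\ C x]) C).
    by apply: closed_bigI => C [[]].
  by apply/seteqP; split=> z zP C; [case=> ? ?|move=> *]; exact: zP.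
suff cnQ : connected (quasi_component x).
  move=> /(connected_component_max Qx (@subsetT _ _) cnQ).
  by rewrite tdT // => /esym.
move=> B [b Bb] [C1 oC1 BC1] [C2 cC2 BC2].
have cB : closed B by rewrite BC2; exact: closedI.
have cB' : closed (quasi_component x `&` ~` C1) by apply: closedI => //;
  exact: open_closedC.
have BB' : B `&` (quasi_component x `&` ~` C1) = set0.
  by rewrite BC1; apply/seteqP; split=> // z [[_ ?] [_]].
have BUB' : B `|` (quasi_component x `&` ~` C1) = quasi_component x.
  by rewrite BC1 -setIUr setUv setIT.
have [Bx|nBx] := pselect (B x).
  by rewrite -[RHS]BUB' (quasi_component_split cB cB' BB' BUB' Bx) setU0.
have B'x : (quasi_component x `&` ~` C1) x by move: Qx; rewrite -{1}BUB' => -[].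
have := quasi_component_split cB' cB; rewrite setIC setUC =>
  /(_ x BB' BUB' B'x) B0.
by move: Bb; rewrite B0.
Qed.

End ZeroDimensional.

Section Translation.
Variable G : topologicalZmodType.

Lemma nbhs_translate (x : G) (A : set G) : nbhs x A ->
  nbhs (0 : G) [set z | A (x + z)].
Proof.
move=> xA; have := @add_continuous G (x, 0).
rewrite /continuous_at /= addr0 => /(_ _ xA)[[B C] /= [Bx C0] BC].
by apply: filterS C0 => z Cz; apply: (BC (x, z)); split=> //;
  exact: nbhs_singleton.
Qed.

Lemma nbhs_translateN (x : G) (A : set G) : nbhs (0 : G) A ->
  nbhs x [set z | A (z - x)].
Proof.
move=> A0; have := @sub_continuous G (x, x).
rewrite /continuous_at /= subrr => /(_ _ A0)[[B C] /= [Bx Cx] BC].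
by apply: filterS Bx => z Bz; apply: (BC (z, x)); split=> //;
  exact: nbhs_singleton.
Qed.

Lemma open_subgroup (U : zmodClosed G) : nbhs (0 : G) [set` U] -> open [set` U].
Proof.
move=> U0; rewrite openE => x /= xU; apply: filterS (nbhs_translateN x U0) =>
  z /= zU.
by rewrite -(subrK x z) rpredD.
Qed.

Lemma open_coset (U : zmodClosed G) x : open [set` U] ->
  nbhs x [set z | z - x \in U].
Proof.
move=> oU; apply: (@nbhs_translateN x [set` U]); apply: open_nbhs_nbhs;
  split=> //.
exact: rpred0.
Qed.

Section Stabilizer.
Variable C : set G.
Definition stabilizer : {pred G} := [pred x | `[< forall y,
  C y <-> C (y + x) >] ].
Lemma stabilizer_closed : zmod_closed stabilizer.
Proof.
split=> [|x y /asboolP xC /asboolP yC]; apply/asboolP => z;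
  first by rewrite addr0.
by rewrite xC (yC (z + (x - y))) -addrA subrK.
Qed.
HB.instance Definition _ := GRing.isZmodClosed.Build G stabilizer
  stabilizer_closed.
End Stabilizer.

Let near_stable (C : set G) : compact C -> open C ->
  nbhs (0 : G) [set x | forall y, C y -> C (y + x)].
Proof.
move=> cC oC; have /compact_near_coveringP := cC.
apply=> y Cy; have := @add_continuous G (y, 0).
by apply; rewrite /= addr0; exact: open_nbhs_nbhs.
Qed.

(** Take a clopen [C] with 0 in [C] and [C] inside [V]. Its stabilizer under translation lies in
    [C], and is open by compactness of [C] and of its complement ([near_stable]). *)
Lemma open_subgroup_basis (V : set G) : profinite G -> nbhs (0 : G) V ->
  exists U : zmodClosed G, open [set` U] /\ [set` U] `<=` V.
Proof.
move=> [cG hG tG] V0; have zG := compact_zero_dimensional cG hG tG.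
have [C [C0 [oC cC]] CV] := zero_dimensional_cvg hG zG cG V0.
exists (stabilizer C : zmodClosed _); split; last first.
  by move=> x /asboolP /(_ 0); rewrite add0r => -[/(_ C0)/CV].
apply: open_subgroup.
have n1 := near_stable (subclosed_compact cC cG (@subsetT _ _)) oC.
have n2 : nbhs (0 : G) [set x | forall y, (~` C) y -> (~` C) (y + x)].
  apply: near_stable; last exact: closed_openC.
  by apply: (subclosed_compact _ cG) => //; exact: open_closedC.
apply: filterS2 n1 n2 => x x1 x2; apply/asboolP => y; split; first exact: x1.
by move=> Cyx; apply: contrapT => /x2.
Qed.

Lemma closed_subgroup_separated (K : zmodClosed G) x : profinite G ->
    closed [set` K] -> x \notin K ->
  exists U : zmodClosed G, open [set` U] /\ forall z, z \in U -> x + z \notin K.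
Proof.
move=> pG cK xK; have : nbhs x (~` [set` K]).
  by apply: open_nbhs_nbhs; split; [exact: closed_openC|exact/negP].
move=> /nbhs_translate/(open_subgroup_basis pG)[U [oU UK]].
by exists U; split=> // z /UK /= /negP.
Qed.

End Translation.

(** * Characters *)

(** Translation by [x] permutes the group, so the sum of all elements equals itself plus [n x]. *)
Lemma mulrn_card_eq0 (X : zmodType) n (x : X) : ([set: X] #= `I_n)%card ->
  x *+ n = 0.
Proof.
move=> Xn; have sX : finite_set [set: X] by apply/finite_setP; exists n.
pose s : seq X := fset_set [set: X].
have ss y : y \in s by rewrite in_fset_set // in_setT.
have us : uniq s by exact: fset_uniq.
have ps : perm_eq s [seq y + x | y <- s].
  apply: uniq_perm => //; first by rewrite map_inj_uniq //; exact: addIr.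
  by move=> y; rewrite ss; apply/esym/mapP; exists (y - x) => //; rewrite subrK.
have := perm_big (R := X) (x := 0) (op := +%R) _ ps (P := predT) (F := id).
rewrite big_map big_split /= big_const_seq count_predT iter_addr_0 -{1}[\sum_(_
  <- s) _]addr0.
by move=> /addrI/esym; rewrite (card_fset_set Xn).
Qed.

Lemma open_subgroup_exponent p (G : topologicalZmodType) (U : zmodClosed G) :
  pro_p p G -> open [set` U] -> exists n, forall x, x *+ p ^ n \in U.
Proof.
move=> [_ /(_ U)] + oU => /(_ oU)[n Un]; exists n => x.
have := mulrn_card_eq0 (quotient_map U x) Un.
rewrite -raddfMn /= -(raddf0 (quotient_map U)).
by move=> /quotient_map_eqP; rewrite subr0.
Qed.

Lemma open_subgroup_cosets p (G : topologicalZmodType) (U : zmodClosed G) :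
  pro_p p G -> open [set` U] ->
  exists rs : seq G, forall x, exists2 r, r \in rs & x - r \in U.
Proof.
move=> [_ /(_ U)] + oU => /(_ oU)[n Un].
have /finite_seqP[s sE] : finite_set [set: quotient_group U].
  by apply/finite_setP; exists (p ^ n)%N.
have [r rK] := choice (@quotient_map_surj G U).
exists (map r s) => x; exists (r (quotient_map U x)).
  apply: map_f; have : [set: quotient_group U] (quotient_map U x) by [].
  by rewrite sE.
by apply/quotient_map_eqP; rewrite rK.
Qed.

Section Dual.
Variable G : topologicalZmodType.

(** Vanishing near 0 is continuity for the discrete topology on Q/Z. For profinite [G] these are all
    the characters into the circle, whose small neighbourhoods of 0 contain no nontrivial
    subgroup. *)
Definition is_character : {pred G -> QZ} :=
  [pred f | `[< zmod_morphism f /\ nbhs (0 : G) [set x | f x = 0] >] ].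
Lemma is_character_closed : zmod_closed is_character.
Proof.
split=> [|f g /asboolP[fB f0] /asboolP[gB g0]]; apply/asboolP; split.
- by move=> x y; rewrite subrr.
- by apply: filterS filterT => x _ /=.
- by move=> x y; rewrite !fctE /= fB gB subrB_interchange.
- by apply: filterS2 f0 g0 => x /= fx gx; rewrite !fctE /= fx gx subrr.
Qed.
HB.instance Definition _ :=
  GRing.isZmodClosed.Build (G -> QZ) is_character is_character_closed.

Definition dual : Type := {f : G -> QZ | f \in is_character}.
HB.instance Definition _ := SubChoice.copy dual {f : G ->
  QZ | f \in is_character}.
HB.instance Definition _ := [SubChoice_isSubZmodule of dual by <:].

Definition dual_fun (chi : dual) : G -> QZ := val chi.
Coercion dual_fun : dual >-> Funclass.

Lemma dual_is_zmod_morphism (chi : dual) : zmod_morphism chi.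
Proof. by have /asboolP[] := valP chi. Qed.
HB.instance Definition _ (chi : dual) :=
  GRing.isZmodMorphism.Build G QZ (dual_fun chi) (dual_is_zmod_morphism chi).

Lemma dual_kernel_nbhs (chi : dual) : nbhs (0 : G) [set x | chi x = 0].
Proof. by have /asboolP[] := valP chi. Qed.

Lemma dual_eqP (chi psi : dual) : (forall x, chi x = psi x) -> chi = psi.
Proof. by move=> e; apply: val_inj; apply/funext. Qed.

Lemma dual0E x : (0 : dual) x = 0. Proof. by []. Qed.

Lemma dualBE (chi psi : dual) x : dual_fun (chi - psi) x = chi x - psi x.
Proof. by []. Qed.

Lemma dualMnE (chi : dual) n x : dual_fun (chi *+ n) x = chi x *+ n.
Proof. by elim: n => // n IH; rewrite !mulrSr -IH. Qed.

Lemma dualMzE (chi : dual) (k : int) x : dual_fun (chi *~ k) x = chi x *~ k.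
Proof.
case: k => n; first exact: dualMnE.
by rewrite !NegzE !mulrNz; congr (- _); exact: dualMnE.
Qed.

Lemma dual_intro (f : G -> QZ) : zmod_morphism f ->
  nbhs (0 : G) [set x | f x = 0] ->
  exists chi : dual, forall x, chi x = f x.
Proof.
move=> fB f0; have fP : f \in is_character by apply/asboolP.
by exists (exist _ f fP).
Qed.

Lemma dual_locally_constant (chi : dual) x : nbhs x [set z | chi z = chi x].
Proof.
apply: filterS (nbhs_translateN x (dual_kernel_nbhs chi)) => z /=.
by rewrite raddfB => /eqP; rewrite subr_eq0 => /eqP.
Qed.

Lemma dual_preimage_open (chi : dual) (D : set QZ) : open [set x | D (chi x)].
Proof.
by rewrite openE => x /= Dx; apply: filterS (dual_locally_constant chi x) =>
  z /= ->.
Qed.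

Lemma dual_preimage_closed (chi : dual) (D : set QZ) :
  closed [set x | D (chi x)].
Proof.
by rewrite -[X in closed X]setCK; apply: open_closedC;
  exact: (dual_preimage_open chi (~` D)).
Qed.

Lemma dual_kernel_sup (chi : dual) : profinite G ->
  exists U : zmodClosed G, open [set` U] /\ forall x, x \in U -> chi x = 0.
Proof.
by move=> pG; exact: (open_subgroup_basis pG (dual_kernel_nbhs chi)).
Qed.

Section Annihilator.
Variable K : zmodClosed G.
Definition annihilator : {pred dual} := [pred chi : dual | `[< forall x,
  x \in K -> chi x = 0 >] ].
Lemma annihilator_closed : zmod_closed annihilator.
Proof.
split=> [|f g /asboolP f0 /asboolP g0]; apply/asboolP => x xK //.
by rewrite dualBE f0 // g0 // subrr.
Qed.
HB.instance Definition _ := GRing.isZmodClosed.Build dual annihilator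
  annihilator_closed.
End Annihilator.

Section ZeroGraph.
Variable U : zmodClosed G.
Definition zero_graph : {pred (G * QZ)%type} :=
  [pred e | (e.1 \in U) && (e.2 == 0)].
Lemma zero_graph_closed : zmod_closed zero_graph.
Proof.
split=> [|x y]; rewrite !inE /=; first by rewrite rpred0 eqxx.
by move=> /andP[xU /eqP->] /andP[yU /eqP->]; rewrite rpredB // subrr eqxx.
Qed.
HB.instance Definition _ :=
  GRing.isZmodClosed.Build (G * QZ)%type zero_graph zero_graph_closed.
End ZeroGraph.

End Dual.

Section ProPDual.
Variables (p : nat) (G : topologicalZmodType).
Hypotheses (p_pr : prime p) (Gp : pro_p p G).

Let p_gt0 n : (0 < p ^ n)%N. Proof. by rewrite expn_gt0 prime_gt0. Qed.

(** Modulo the open subgroup [U] the group is finite of [p]-power exponent, so [hom_extension]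
    applies; killing [U] makes the result continuous. *)
Lemma dual_extension (R : zmodClosed (G * QZ)%type) (U : zmodClosed G) :
    open [set` U] -> single_valued R -> (forall u, u \in U -> (u, 0) \in R) ->
  exists chi : dual G, forall x d, (x, d) \in R -> chi x = d.
Proof.
move=> oU Rs UR; have [n Un] := open_subgroup_exponent Gp oU.
have [rs rsP] := open_subgroup_cosets Gp oU.
have [x|x|f fB fR] := @hom_extension _ R rs Rs.
- by exists (p ^ n)%N, 0; split=> //; exact: UR.
- by have [r rrs xr] := rsP x; exists r, 0; split=> //; exact: UR.
have [|chi chiE] := dual_intro fB; last by exists chi => x d /fR <-.
apply: (@filterS _ _ _ [set` U]) => [x /= /UR/fR//|].
by apply: open_nbhs_nbhs; split=> //; exact: rpred0.
Qed.

Lemma dual_primary (chi : dual G) : exists n, chi *+ p ^ n = 0.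
Proof.
have [U [oU Uchi]] := dual_kernel_sup chi Gp.1.
have [n Un] := open_subgroup_exponent Gp oU; exists n.
by apply: dual_eqP => x; rewrite dualMnE -raddfMn /= Uchi.
Qed.

(** Choose an open [U] missing [x] and the least [m] with [m x] in [U]; sending [x] to a nonzero
    [m]-torsion element of Q/Z and [U] to 0 is consistent. *)
Lemma dual_separates (x : G) : x != 0 -> exists chi : dual G, chi x != 0.
Proof.
move=> x0; have [_ hG _] := Gp.1.
have : nbhs (0 : G) (~` [set x]).
  apply: open_nbhs_nbhs; split; last by move=> /= x0'; rewrite x0' eqxx in x0.
  by apply: closed_openC; apply: accessible_closed_set1;
    exact: hausdorff_accessible.
move=> /(open_subgroup_basis Gp.1)[U [oU xU]].
have {}xU : x \notin U by apply/negP => /xU; exact.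
have ex : exists m, (0 < m)%N && (x *+ m \in U).
  by have [n Un] := open_subgroup_exponent Gp oU; exists (p ^ n)%N;
    rewrite p_gt0 Un.
have [m /andP[m0 xm] mmin] := ex_minnP ex.
have m1 : (1 < m)%N.
  by case: m m0 xm {mmin} => [|[|m]] // _; rewrite mulr1n (negPf xU).
have [c c0 cm] := qz_order m1.
have xcm : (x, c) *+ m \in zero_graph U.
  by rewrite [_ *+ _]surjective_pairing !raddfMn /= inE /= xm cm eqxx.
have [d /(adjoin_mulrn m0 xcm)[r rm]|u uU|chi chiE] :=
    dual_extension (R := adjoin (zero_graph U) (x, c)) oU.
- have -> : (0, d) - (x, c) *+ r = (- (x *+ r), d - c *+ r).
    by rewrite [LHS]surjective_pairing !raddfB !raddfMn /= add0r !mulNrn.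
  move=> xr_in; have /andP[] : (- (x *+ r) \in U) && (d - c *+ r == 0) by [].
  rewrite rpredN; case: r rm {xr_in} => [|r] rm xr;
    first by rewrite mulr0n subr0 => /eqP.
  have /mmin : (0 < r.+1)%N && (x *+ r.+1 \in U) by [].
  by rewrite leqNgt rm.
- by apply: sub_adjoin; rewrite inE /= uU eqxx.
by exists chi; rewrite (chiE x c) // mem_adjoin.
Qed.

(** A character is coded by a basic neighbourhood inside its kernel and its values on
    representatives modulo an open subgroup contained in that neighbourhood; there are countably
    many codes. *)
Lemma dual_enumeration : countably_based G ->
  exists a : nat -> dual G, forall chi, exists n, a n = chi.
Proof.
move=> [B [/countable_injP[g gI] B0 Bbase]].
have [W WP] := choice (fun V : {V : set G | nbhs (0 : G) V} =>
  open_subgroup_basis Gp.1 (svalP V)).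
have [rs rsP] := choice (fun V => open_subgroup_cosets Gp (WP V).1).
have baseP (chi : dual G) : exists V : {V : set G | nbhs (0 : G) V},
    B (sval V) /\ sval V `<=` [set x | chi x = 0].
  have [V BV Vchi] := Bbase _ (dual_kernel_nbhs chi).
  by exists (exist _ V (B0 V BV)).
have [V VP] := choice baseP.
pose code chi : nat * seq rat :=
  (g (sval (V chi)), [seq qz_repr (chi r) | r <- rs (V chi)]).
have codeI : injective code.
  move=> chi psi [gV]; have eV : V chi = V psi.
    have [Bchi _] := VP chi; have [Bpsi _] := VP psi.
    have /= := gI _ _ (mem_set Bchi) (mem_set Bpsi) gV.
    by case: (V chi) (V psi) => [U1 N1] [U2 N2] /=; exact: eq_exist.
  rewrite eV => /eq_in_map e; apply: dual_eqP => x.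
  have [r rrs xr] := rsP (V psi) x.
  have Wker (phi : dual G) : V phi = V psi -> phi x = phi r.
    move=> ephi; apply/eqP; rewrite -subr_eq0 -raddfB; apply/eqP.
    by have [_] := VP phi; apply; rewrite ephi; apply: (WP _).2.
  by rewrite !Wker // -[LHS]qz_reprK -[RHS]qz_reprK e.
pose a n : dual G :=
  if pselect (exists chi, choice.pickle (code chi) = n)
    is left h then sval (cid h) else 0.
exists a => chi; exists (choice.pickle (code chi)); rewrite /a.
case: pselect => [h|]; last by case; exists chi.
by case: (cid h) => psi /= /(pcan_inj choice.pickleK)/codeI.
Qed.

End ProPDual.

(** * Annihilators of the torsion series *)

Section MulImage.
Variables (V : zmodType) (K : zmodClosed V) (n : nat).
Definition mul_image : {pred V} := [pred x | `[< exists2 y,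
  y \in K & x = y *+ n >] ].
Lemma mul_image_closed : zmod_closed mul_image.
Proof.
split=> [|_ _ /asboolP[x xK ->] /asboolP[y yK ->]]; apply/asboolP.
  by exists 0; rewrite ?rpred0 // mul0rn.
by exists (x - y); rewrite ?rpredB // mulrnBl.
Qed.
HB.instance Definition _ := GRing.isZmodClosed.Build V mul_image
  mul_image_closed.
End MulImage.

Lemma coprime_mulrn_eq0 (V : zmodType) (x : V) m n :
  (0 < m)%N -> coprime m n -> x *+ m = 0 -> x *+ n = 0 -> x = 0.
Proof.
move=> m0 mn xm xn; case: (egcdnP n m0) => u v uv _; rewrite (eqP mn) in uv.
have : x *+ (u * m) = x *+ (v * n + 1) by rewrite uv.
by rewrite mulnC mulrnA xm mul0rn addn1 mulrS mulnC mulrnA xn mul0rn addr0.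
Qed.

Lemma oeq_cases a : [\/ oeq a ozero, exists b, oeq a (osucc b) | olimit a].
Proof.
have [a0|na0] := pselect (oeq a ozero); first exact: Or31.
have [ab|nab] := pselect (exists b, oeq a (osucc b)); first exact: Or32.
by apply: Or33; split=> // b ab; apply: nab; exists b.
Qed.

Section SeriesClosed.
Variable G : topologicalZmodType.

Lemma closure_subgroup_is_closed (K : zmodClosed G) :
  closed [set` closure_subgroup K].
Proof.
rewrite (_ : [set` closure_subgroup K] = closure [set` K]);
  first exact: closed_closure.
by apply/seteqP; split=> x /asboolP.
Qed.

Lemma closure_subgroup_min (K L : zmodClosed G) : closed [set` L] ->
  {subset K <= L} -> {subset closure_subgroup K <= L}.
Proof.
move=> cL KL x /asboolP xK.
by have := closure_subset (KL : [set` K] `<=` [set` L]) xK;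
  rewrite -(iffLR (closure_id _) cL).
Qed.

End SeriesClosed.

Lemma torsion_step_closed (G : topologicalZmodType) (K : zmodClosed G) :
  closed [set` torsion_step K].
Proof.
pose C := [set` closure_subgroup (torsion_subgroup (quotient_group K))].
apply: (@closed_comp _ _ (quotient_map K) C);
  last exact: closure_subgroup_is_closed.
by move=> x _; exact: quotient_map_continuous.
Qed.

Lemma torsion_series_closed (G : topologicalZmodType) a : hausdorff_space G ->
  closed [set` torsion_series G a].
Proof.
move=> hG; case: (oeq_cases a) => [/torsion_series_oeq->|[b
  /torsion_series_oeq->]|la].
- rewrite torsion_series0 (_ : [set` trivial_subgroup G] = [set 0]).
    by apply: accessible_closed_set1; exact: hausdorff_accessible.
  by apply/seteqP; split=> x /eqP.
- by rewrite torsion_seriesS; exact: torsion_step_closed.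
by rewrite torsion_series_lim //; exact: closure_subgroup_is_closed.
Qed.

Section MulGraph.
Variables (G : topologicalZmodType) (K U : zmodClosed G) (m : nat) (chi :
  dual G).
Definition mul_graph : {pred (G * QZ)%type} :=
  [pred e | `[< exists x k, [/\ k \in K, e.1 - x *+ m - k \in U & e.2 = chi x]
    >] ].
Lemma mul_graph_closed : zmod_closed mul_graph.
Proof.
split=> [|e f /asboolP[x [k [kK xU eE]]] /asboolP[y [l [lK yU fE]]]];
  apply/asboolP.
  by exists 0, 0; split; rewrite ?mul0rn /= ?subr0 ?rpred0 ?raddf0.
exists (x - y), (k - l); split; first exact: rpredB.
  by have := rpredB xU yU; rewrite subrB_interchange [e.1 - _ -
    _]subrB_interchange -mulrnBl.
by rewrite [RHS]raddfB /= -eE -fE.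
Qed.
HB.instance Definition _ :=
  GRing.isZmodClosed.Build (G * QZ)%type mul_graph mul_graph_closed.
End MulGraph.

Section Annihilators.
Variables (p : nat) (G : topologicalZmodType).
Hypotheses (p_pr : prime p) (Gp : pro_p p G).

(* Compactness replaces the condition [m x \in K -> chi x = 0] by the same   *)
(* condition for [K + U] with [U] open, so that [m x |-> chi x] extends to a *)
(* continuous character.                                                     *)
Lemma annihilator_divide (K : zmodClosed G) (chi : dual G) m :
  closed [set` K] ->
    (forall x, x *+ m \in K -> chi x = 0) ->
  chi \in mul_image (annihilator K) m.
Proof.
move=> cK chiK; have [cG hG tG] := Gp.1.
pose C := [set x | chi x <> 0].
have /compact_near_coveringP nC : compact C.
  have cC : closed C := @dual_preimage_closed G chi [set d | d <> 0].
  exact: (subclosed_compact cC cG (@subsetT _ _)).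
have : nbhs (0 : G) [set i | C `<=` [set x | x *+ m + i \notin K]].
  apply: nC => x Cx; have xK : x *+ m \notin K by apply/negP => /chiK.
  have [U [oU UK]] := closed_subgroup_separated Gp.1 cK xK.
  exists ([set z | z - x \in U], [set` U]).
    split; first exact: open_coset.
    by apply: open_nbhs_nbhs; split=> //; exact: rpred0.
  move=> [z i] /= [zU iU]; rewrite -(subrK x z)
    mulrnDl [_ *+ m + _]addrC -addrA.
  by apply: UK; rewrite rpredD // rpredMn.
move=> /(open_subgroup_basis Gp.1)[U [oU UC]].
have [d /asboolP[x [k [kK xU /= dE]]]|u uU|psi psiE] :=
    dual_extension p_pr Gp (R := mul_graph K U m chi) oU.
- rewrite dE; apply: contrapT => /(UC _ xU) /=.
  by rewrite sub0r addrA subrr sub0r rpredN kK.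
- by apply/asboolP; exists 0, 0; split; rewrite ?mul0rn /= ?subr0 ?rpred0
    ?raddf0.
apply/asboolP; exists psi.
  apply/asboolP => k kK; apply: psiE; apply/asboolP; exists 0, k.
  by split; rewrite ?mul0rn /= ?subr0 ?subrr ?rpred0 ?raddf0.
apply: dual_eqP => x; rewrite dualMnE -raddfMn /=; apply/esym/psiE/asboolP.
by exists x, 0; split; rewrite /= ?subrr ?subr0 ?rpred0.
Qed.

(** Dually, passing from [T_a] to [T_(a+1)] is taking the elements of infinite height. A character
    in this annihilator kills all [x] with [p ^ n x] in [K], so [annihilator_divide] applies; the
    converse shows that its kernel modulo [K] is closed and contains the torsion. *)
Lemma annihilator_torsion_step (K : zmodClosed G) (chi : dual G) :
  closed [set` K] ->
  chi \in annihilator (torsion_step K) <->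
  forall n, chi \in mul_image (annihilator K) (p ^ n).
Proof.
move=> cK; split=> [/asboolP chi0 n|chi_div].
  apply: annihilator_divide => // x xK; apply: chi0;
    apply/asboolP/subset_closure.
  apply/asboolP; exists (p ^ n)%N; first by rewrite expn_gt0 prime_gt0.
  rewrite -raddfMn /= -(raddf0 (quotient_map K)).
  by apply/quotient_map_eqP; rewrite subr0.
have chiK x : x \in K -> chi x = 0.
  by have /asboolP[psi /asboolP psiK ->] := chi_div 0;
    rewrite dualMnE => /psiK ->.
pose Z : set (quotient_group K) := quotient_map K @` [set x | chi x = 0].
have cZ : closed Z.
  rewrite -[Z]setCK; apply: open_closedC.
  rewrite (_ : ~` Z = quotient_map K @` [set x | chi x <> 0]).
    exact: (quotient_map_open K (@dual_preimage_open G chi [set d | d <> 0])).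
  apply/seteqP; split=> [a nZ|_ [x chix <-] [y chiy] /quotient_map_eqP yx].
    have [x xa] := quotient_map_surj a; exists x => //= chix.
    by apply: nZ; exists x.
  apply: chix; apply/eqP; move/chiK/eqP: yx.
  by rewrite raddfB /= chiy sub0r oppr_eq0.
have torZ : [set` torsion_subgroup (quotient_group K)] `<=` Z.
  move=> a /asboolP[n n0]; have [x <-] := quotient_map_surj a.
  rewrite -raddfMn /= -(raddf0 (quotient_map K)) => /quotient_map_eqP.
  rewrite subr0 => xn; exists x => //=.
  (* Write [n] as a power of [p] times [q]. Dividing [chi] by that power shows that [q] kills
     [chi x], and so does a power of [p]. *)
  have [q pq nE] := pfactor_coprime p_pr n0.
  have [N chiN] := dual_primary Gp chi.
  have pN : (0 < p ^ N)%N by rewrite expn_gt0 prime_gt0.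
  apply: (coprime_mulrn_eq0 pN (coprimeXl N pq));
    first by rewrite -dualMnE chiN.
  have /asboolP[psi /asboolP psiK ->] := chi_div (logn p n).
  by rewrite dualMnE -mulrnA -[(_ * q)%N]mulnC -nE -raddfMn /= psiK.
apply/asboolP => x /asboolP /(closure_subset torZ);
  rewrite -(iffLR (closure_id _) cZ).
move=> -[y chiy] /quotient_map_eqP yx.
by apply/eqP; move/chiK/eqP: yx; rewrite raddfB /= chiy sub0r oppr_eq0.
Qed.

Lemma annihilator_torsion_series_lim a (chi : dual G) : olimit a ->
  (forall b, olt b a -> chi \in annihilator (torsion_series G b)) ->
  chi \in annihilator (torsion_series G a).
Proof.
move=> la chib; rewrite torsion_series_lim //; apply/asboolP.
pose L := preimage_subgroup chi (zero_subgroup QZ).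
have cL : closed [set` L].
  rewrite (_ : [set` L] = [set x | [set 0] (chi x)]);
    first exact: dual_preimage_closed.
  by apply/seteqP; split=> x /eqP.
move=> x /(closure_subgroup_min cL) xL; apply/eqP; apply: xL => y /asboolP.
move=> /(_ (L : zmodClosed _)); apply => z [b /chib/asboolP chi0] /chi0 chiz.
exact/eqP.
Qed.

End Annihilators.

(** Where the series stops, the quotient is torsion-free, hence trivial. *)
Lemma dual_reduced_torsion_type (G : topologicalZmodType) t :
  hausdorff_space G ->
  dual_reduced G -> torsion_type G t -> forall x, x \in torsion_series G t.
Proof.
move=> hG rG [tt _] x; rewrite -[x]subr0; apply/quotient_map_eqP;
  rewrite raddf0.
apply: rG; first exact: torsion_series_closed.
move=> a n n0 an; have [y ya] := quotient_map_surj a; move: an.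
rewrite -ya -[X in _ -> _ = X](raddf0 (quotient_map _)) => an.
apply/quotient_map_eqP; rewrite subr0 tt torsion_seriesS;
  apply/asboolP/subset_closure.
by apply/asboolP; exists n.
Qed.

(** * From character groups back to groups *)

Section CommonKernel.
Variables (H : topologicalZmodType) (s : seq (dual H)).
Definition common_kernel : {pred H} := [pred h | all (fun b : dual H =>
  b h == 0) s].
Lemma common_kernel_closed : zmod_closed common_kernel.
Proof.
split=> [|x y /allP x0 /allP y0]; apply/allP => b bs; first by rewrite raddf0.
by rewrite raddfB /= (eqP (x0 b bs)) (eqP (y0 b bs)) subrr.
Qed.
HB.instance Definition _ := GRing.isZmodClosed.Build H common_kernel
  common_kernel_closed.
End CommonKernel.

Section DualCorrespondence.
Variables (p : nat) (G H : topologicalZmodType).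
Hypotheses (p_pr : prime p) (Hp : pro_p p H).
Variable K : zmodClosed (dual G * dual H)%type.
Hypothesis K_right : forall psi, exists chi, (chi, psi) \in K.
Hypothesis K_eq0 : forall chi psi, (chi, psi) \in K -> chi = 0 <-> psi = 0.

Lemma dual_image_order (L : zmodClosed H) (b : dual H) :
  (forall h, h \in L -> b h = 0) \/
  exists n g, [/\ g \in L, b g *+ p ^ n != 0 & forall h, h \in L ->
    b h *+ p ^ n.+1 = 0].
Proof.
have [b0|/existsNP[h0 /not_implyP[h0L /eqP bh0]]] :=
  pselect (forall h, h \in L -> b h = 0).
  by left.
right; have [N bN] := dual_primary Hp b.
pose P n := `[< exists2 g, g \in L & b g *+ p ^ n != 0 >].
have exP : exists n, P n by exists 0%N; apply/asboolP; exists h0.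
have boundP n : P n -> (n <= N)%N.
  move=> /asboolP[g _]; apply: contraR; rewrite -ltnNge => /ltnW/subnKC <-.
  by rewrite expnD mulrnA -dualMnE bN mul0rn.
have [n /asboolP[g gL bg] nmax] := ex_maxnP exP boundP.
exists n, g; split=> // h hL; apply/eqP/negPn/negP => bh.
by have := nmax n.+1 (asboolT (ex_intro2 _ _ h hL bh)); rewrite ltnn.
Qed.

(** The image of [L] under [b] is a finite cyclic p-group, generated by some [b g]; the order of
    [w g] divides that of [b g], so [w g] is a multiple of [b g]. *)
Lemma dual_divides (L : zmodClosed H) (b w : dual H) :
    (forall h, h \in L -> b h = 0 -> w h = 0) ->
  exists k : int, forall h, h \in L -> w h = b h *~ k.
Proof.
move=> bw; have [b0|[n [g [gL bg bL]]]] := dual_image_order L b.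
  by exists 0 => h hL; rewrite mulr0z bw // b0.
have wg : w g *+ p ^ n.+1 = 0 by rewrite -raddfMn /= bw ?rpredMn // raddfMn bL.
have [k wk] := qz_torsion_cyclic p_pr (bL g gL) bg wg; exists k => h hL.
have [j bj] := qz_torsion_cyclic p_pr (bL g gL) bg (bL h hL).
have /eqP : w (h - g *~ j) = 0.
  by rewrite bw ?rpredB ?rpredMz // raddfB raddfMz /= bj subrr.
rewrite raddfB raddfMz /= subr_eq0 => /eqP->.
by rewrite wk bj -!mulrzA mulrC.
Qed.

(** A character vanishing on a finite intersection of kernels is an integral combination of the
    given characters; the same combination on the other side is its partner. *)
Lemma correspondence_span (s : seq (dual G * dual H)) (w : dual H) :
  {subset s <= K} ->
    (forall h, h \in common_kernel (map snd s) -> w h = 0) ->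
  exists2 chi : dual G, (chi, w) \in K &
    forall g h, (forall e, e \in s -> dual_fun e.1 g = dual_fun e.2 h) ->
      chi g = w h.
Proof.
elim: s w => [|e s IH] w sK ws.
  have -> : w = 0 by apply: dual_eqP => h; rewrite dual0E ws.
  by exists 0 => //; exact: (rpred0 K).
have eK : e \in K by apply: sK; rewrite mem_head.
have [h hs bh|k wk] := @dual_divides (common_kernel (map snd s)) e.2 w.
  by apply: ws; rewrite inE /= bh eqxx.
have [e' e's|h hs|chi chiK chiE] := IH (w - e.2 *~ k).
- by apply: sK; rewrite inE e's orbT.
- by rewrite dualBE dualMzE wk // subrr.
exists (chi + e.1 *~ k) => [|g h gh].
  have := rpredD chiK (rpredMz k eK).
  suff -> : (chi, w - e.2 *~ k) + e *~ k = (chi + e.1 *~ k, w) by [].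
  by rewrite [LHS]surjective_pairing /= !raddfMz /= mulNrz subrK.
have := chiE g h (fun e' e's => gh e' (mem_behead (s := e :: s) e's)).
rewrite dualBE dualMzE => /(congr1 (fun d => d + dual_fun e.1 g *~ k)).
by rewrite {2}(gh e (mem_head _ _)) subrK => <-; rewrite -dualMzE.
Qed.

Lemma correspondence_functional chi chi' psi : (chi, psi) \in K ->
  (chi', psi) \in K -> chi = chi'.
Proof.
move=> c1 c2; have : (chi - chi', psi - psi) \in K by exact: rpredB c1 c2.
by rewrite subrr => /K_eq0[_ /(_ erefl)/eqP]; rewrite subr_eq0 => /eqP.
Qed.

(** A solution [h] for the tail is corrected by some [k] in the common kernel [L] of the tail; the
    point is that the error at the head [e] lies in the image of [L] under [e.2]. *)
Lemma correspondence_interpolation (s : seq (dual G * dual H)) g :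
  {subset s <= K} ->
  exists h, forall e, e \in s -> dual_fun e.1 g = dual_fun e.2 h.
Proof.
elim: s => [|e s IH] sK; first by exists 0.
have eK : e \in K by apply: sK; rewrite mem_head.
have {}sK : {subset s <= K} by move=> e' e's; apply: sK; rewrite inE e's orbT.
have [h hs] := IH sK; set L := common_kernel (map snd s).
suff [k kL bk] : exists2 k, k \in L & e.2 k = dual_fun e.1 g - dual_fun e.2 h.
  exists (h + k) => e'; rewrite inE => /orP[/eqP->|e's].
    by rewrite raddfD /= bk addrC subrK.
  rewrite raddfD /= (hs _ e's) (_ : dual_fun e'.2 k = 0) ?addr0 //.
  by apply/eqP; move/allP: kL; apply; exact: map_f.
(* If [e.2] kills [L] it depends on the tail and the error is 0. Otherwise its multiple by
   [p ^ n.+1] depends on the tail, so the error is killed by [p ^ n.+1] and lies in the cyclic image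
   of [L]. *)
have [b0|[n [k [kL bk bL]]]] := dual_image_order L e.2.
  have [chi chiK /(_ g h hs) chigh] := correspondence_span sK b0.
  exists 0; rewrite ?rpred0 // raddf0 -chigh (correspondence_functional chiK (_
    : (e.1, e.2) \in K)).
    by rewrite subrr.
  by rewrite -surjective_pairing.
have [x xL|chi chiK /(_ g h hs) chigh] := correspondence_span (w :=
  e.2 *+ p ^ n.+1) sK.
  by rewrite dualMnE bL.
have chiE : chi = e.1 *+ p ^ n.+1.
  apply: (correspondence_functional chiK); have := rpredMn (p ^ n.+1) eK.
  by rewrite [X in X \in _ -> _]surjective_pairing !raddfMn.
have dn : (dual_fun e.1 g - dual_fun e.2 h) *+ p ^ n.+1 = 0.
  by rewrite mulrnBl -!dualMnE -chiE chigh subrr.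
have [j ->] := qz_torsion_cyclic p_pr (bL k kL) bk dn.
by exists (k *~ j); rewrite ?rpredMz // raddfMz.
Qed.

Definition matched g h := forall (chi : dual G) (psi : dual H), (chi,
  psi) \in K -> chi g = psi h.

(** If every [h] violated some pair of [K], compactness would give a finite list of pairs such that
    every [h] violates one of them, against interpolation. *)
Lemma matched_exists g : exists h, matched g h.
Proof.
apply: contrapT => nE; have [/compact_near_coveringP cH _ _] := Hp.1.
pose F := filter_from [set s : seq (dual G * dual H) | {subset s <= K}]
  (fun s => [set s' : seq (dual G * dual H) | {subset s <= s'}]).
have FF : Filter F.
  apply: filter_from_filter; first by exists [::].
  move=> s1 s2 s1K s2K; exists (s1 ++ s2).
    by move=> e; rewrite mem_cat => /orP[/s1K|/s2K].
  by move=> s' s12; split=> e es; apply: s12; rewrite mem_cat es ?orbT.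
have [h _|s sK sF] := cH _ F
    (fun (s : seq (dual G * dual H)) h => exists2 e,
      e \in s & dual_fun e.1 g <> dual_fun e.2 h) FF.
  have [chi /existsNP[psi /not_implyP[cK ne]]] : exists chi, ~ forall psi,
      (chi, psi) \in K -> dual_fun chi g = dual_fun psi h.
    by apply/existsNP => hE; apply: nE; exists h.
  exists ([set h' | dual_fun psi h' = dual_fun psi h], [set s :
    seq (dual G * dual H) | (chi, psi) \in s]).
    split; first exact: dual_locally_constant.
    exists [:: (chi, psi)]; first by move=> e; rewrite inE => /eqP->.
    by move=> s'; apply; rewrite mem_head.
  by move=> [h' s] /= [ph' es]; exists (chi, psi); rewrite //= ph'.
have [h hs] := @correspondence_interpolation s g sK.
by have [e es] := sF s (fun e es => es) h I; apply; exact: hs.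
Qed.

Lemma matched_unique g h h' : matched g h -> matched g h' -> h = h'.
Proof.
move=> gh gh'; apply/eqP; rewrite -subr_eq0; apply/negPn/negP.
move=> /(dual_separates p_pr Hp)[psi /negP]; apply.
have [chi cK] := K_right psi.
by rewrite raddfB /= -(gh _ _ cK) -(gh' _ _ cK) subrr.
Qed.

Lemma dual_correspondence_map : exists f : G -> H,
  [/\ zmod_morphism f, continuous f & forall g, matched g (f g)].
Proof.
have [f fP] := choice matched_exists.
have fB : zmod_morphism f.
  move=> x y; apply: (matched_unique (fP _)) => chi psi cK.
  by rewrite !raddfB /= (fP x _ _ cK) (fP y _ _ cK).
exists f; split=> // x V /nbhs_translate /(open_subgroup_basis Hp.1)[U [oU UV]].
have [cH hH tH] := Hp.1.
have /compact_near_coveringP nC : compact (~` [set` U]).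
  by apply: (subclosed_compact _ cH) => //; exact: open_closedC.
(* Each [h] outside [U] is detected by a character pair, locally in [h] and near 0 in [G]; by
   compactness no [y] near 0 is matched outside [U]. *)
have : nbhs (0 : G) [set y | ~` [set` U] `<=` [set h | ~ matched y h]].
  apply: nC => h hU; have h0 : h != 0 by apply/eqP => h0; apply: hU;
    rewrite h0 /= rpred0.
  have [psi psih] := dual_separates p_pr Hp h0; have [chi cK] := K_right psi.
  exists ([set h' | dual_fun psi h' = dual_fun psi h],
    [set y | dual_fun chi y = 0]).
    by split; [exact: dual_locally_constant|exact: dual_kernel_nbhs].
  move=> [h' y] /= [ph' cy] /(_ _ _ cK); rewrite cy ph' => /esym/eqP.
  by rewrite (negPf psih).
move=> /(nbhs_translateN x); apply: filterS => z /= zU.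
have /UV /= : f (z - x) \in U by apply: contrapT => /zU; apply.
by rewrite fB addrC subrK.
Qed.

End DualCorrespondence.

Lemma topologically_isomorphic_dual p (G H : topologicalZmodType)
    (K : zmodClosed (dual G * dual H)%type) :
  prime p -> pro_p p G -> pro_p p H ->
  (forall chi, exists psi, (chi, psi) \in K) ->
  (forall psi, exists chi, (chi, psi) \in K) ->
  (forall chi psi, (chi, psi) \in K -> chi = 0 <-> psi = 0) ->
  topologically_isomorphic G H.
Proof.
move=> p_pr Gp Hp KG KH K0.
have [f [fB fC fK]] := dual_correspondence_map p_pr Hp KH K0.
have K0' psi chi : (psi, chi) \in swap_subgroup K -> psi = 0 <-> chi = 0.
  by move=> /K0[]; split.
have [g [gB gC gK]] :=
  dual_correspondence_map (K := swap_subgroup K) p_pr Gp KG K0'.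
pose fA : {additive G -> H} := HB.pack f (GRing.isZmodMorphism.Build _ _ f fB).
exists fA, g; split=> // x; apply/eqP; rewrite -subr_eq0; apply/negPn/negP.
  move=> /(dual_separates p_pr Gp)[chi /negP]; apply; have [psi cK] := KG chi.
  by rewrite raddfB /= -(gK _ psi chi cK) -(fK _ _ _ cK) subrr.
move=> /(dual_separates p_pr Hp)[psi /negP]; apply; have [chi cK] := KH psi.
by rewrite raddfB /= -(fK _ _ _ cK) -(gK _ psi chi cK) subrr.
Qed.

(** * The filtrations of the character groups *)

(** Here [K] relates [B] to [B'] modulo [C] and [C'], which consist of elements of infinite height.
    If [v = p ^ n y] is killed by [p], a partner [y'] satisfies this only up to [C']: its multiple
    by [p ^ n.+1] is [p ^ n.+2 z] for some [z] in [B'], and [p ^ n (y' - p z)] is a true socle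
    element. *)
Lemma socle_transfer (p : nat) (A A' : zmodType) (B C : zmodClosed A)
    (B' C' : zmodClosed A') (K : zmodClosed (A * A')%type) n m (v : 'I_m -> A) :
  (forall x, x \in B -> exists2 y, y \in B' & (x, y) \in K) ->
  (forall y, y \in B' -> exists2 x, x \in B & (x, y) \in K) ->
  (forall x y, (x, y) \in K -> (x \in C) = (y \in C')) ->
  (forall k, {subset C <= mul_image B (p ^ k)}) ->
  (forall k, {subset C' <= mul_image B' (p ^ k)}) ->
  (forall k, v k \in mul_image B (p ^ n) /\ v k *+ p = 0) ->
  (forall k l, k <> l -> v k - v l \notin mul_image B (p ^ n.+1)) ->
  exists v' : 'I_m -> A',
    (forall k, v' k \in mul_image B' (p ^ n) /\ v' k *+ p = 0) /\
    (forall k l, k <> l -> v' k - v' l \notin mul_image B' (p ^ n.+1)).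
Proof.
move=> BB' B'B CC' CB C'B' vB vI.
have KB x1 y1 x2 y2 : (x1, y1) \in K -> (x2, y2) \in K ->
  (x1 - x2, y1 - y2) \in K.
  exact: rpredB.
have KM x y k : (x, y) \in K -> (x *+ k, y *+ k) \in K.
  suff -> : (x *+ k, y *+ k) = (x, y) *+ k by exact: rpredMn.
  by rewrite [RHS]surjective_pairing !raddfMn.
have step k : exists yz : A * (A' * A'), [/\ yz.1 \in B, v k = yz.1 *+ p ^ n &
    [/\ yz.2.1 \in B', (yz.1, yz.2.1) \in K, yz.2.2 \in B' &
        yz.2.1 *+ p ^ n.+1 = yz.2.2 *+ p ^ n.+2]].
  have [/asboolP[y yB vy] vp] := vB k; have [y' y'B yy'] := BB' y yB.
  have : y' *+ p ^ n.+1 \in C'.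
    have Kp := KM _ _ (p ^ n.+1)%N yy'.
    by rewrite -(CC' _ _ Kp) expnSr mulrnA -vy vp rpred0.
  by move=> /(C'B' n.+2)/asboolP[z zB e]; exists (y, (y', z)).
have [w wP] := choice step.
pose y k := (w k).1; pose y' k := (w k).2.1; pose z k := (w k).2.2.
exists (fun k => (y' k - z k *+ p) *+ p ^ n); split=> [k|k l kl].
  have [yB vy [y'B yy' zB e]] := wP k; split.
    by apply/asboolP; exists (y' k - z k *+ p) => //; rewrite rpredB ?rpredMn.
  by rewrite -mulrnA -expnSr mulrnBl e -mulrnA -expnS subrr.
have [yB vy [y'B yy' zB e]] := wP k; have [ylB vyl [y'lB yy'l zlB el]] := wP l.
apply/negP => /asboolP[b bB be]; have /negP := vI k l kl; apply.
(* Absorbing the corrections [z] turns a congruence between the new elements into one between [y' k]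
   and [y' l], which [K] carries back modulo [C]. *)
pose c := b + (z k - z l).
have cB : c \in B' by rewrite rpredD // rpredB.
have ce : (y' k - y' l) *+ p ^ n = c *+ p ^ n.+1.
  move: be; rewrite -mulrnBl subrB_interchange -mulrnBl mulrnBl -mulrnA -expnS.
  by move=> be'; rewrite [RHS]mulrnDl -be' subrK.
have [d dB dc] := B'B c cB.
have : (y k - y l) *+ p ^ n - d *+ p ^ n.+1 \in C.
  have := KB _ _ _ _ (KM _ _ (p ^ n)%N (KB _ _ _ _ yy' yy'l))
    (KM _ _ (p ^ n.+1)%N dc).
  by rewrite -/(y' k) -/(y' l) ce subrr => /CC' ->; exact: rpred0.
move=> /(CB n.+1) CC.
have : d *+ p ^ n.+1 \in mul_image B (p ^ n.+1) by apply/asboolP; exists d.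
by move=> /(rpredD CC); rewrite subrK vy vyl mulrnBl.
Qed.

Lemma olt_minimal (P : ordnum -> Prop) a : P a ->
  exists2 b, P b & forall c, olt c b -> ~ P c.
Proof.
elim/(well_founded_ind olt_wf): a => a IH Pa.
have [[b [ba Pb]]|n] := pselect (exists b, olt b a /\ P b);
  first exact: IH ba Pb.
by exists a => // c ca Pc; apply: n; exists c.
Qed.

(* [(a, n)] stands for the ordinal [omega a + n]. *)
Definition ulm_index (t : ordnum) : Type := {a : ordnum | olt a t} * nat.
Definition ulm_next (t : ordnum) (i : ulm_index t) : ulm_index t :=
  (i.1, i.2.+1).

Section DualFiltration.
Variables (p : nat) (G : topologicalZmodType) (t : ordnum).
Hypotheses (p_pr : prime p) (Gp : pro_p p G).

Definition dual_filtration (i : ulm_index t) : zmodClosed (dual G) :=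
  mul_image (annihilator (torsion_series G (sval i.1))) (p ^ i.2).

Lemma annihilator_series_le a b : ole a b ->
  {subset annihilator (torsion_series G b) <= annihilator (torsion_series G a)}.
Proof.
move=> ab chi /asboolP chi0; apply/asboolP => x xa.
by apply: chi0; exact: torsion_series_le xa.
Qed.

Lemma annihilator_seriesS a chi :
  chi \in annihilator (torsion_series G (osucc a)) <->
  forall n, chi \in mul_image (annihilator (torsion_series G a)) (p ^ n).
Proof.
rewrite torsion_seriesS; apply: annihilator_torsion_step => //.
by apply: torsion_series_closed; case: Gp => -[].
Qed.

Lemma annihilator_series_lt a b n : olt a b ->
  {subset annihilator (torsion_series G b) <=
          mul_image (annihilator (torsion_series G a)) (p ^ n)}.
Proof.
move=> ab chi chib; apply: (annihilator_seriesS a chi).1.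
by apply: annihilator_series_le chib; case: b ab => J g [j aj] /= _; exists j.
Qed.

Lemma mul_image_leq (V : zmodType) (B : zmodClosed V) m n : (m <= n)%N ->
  {subset mul_image B (p ^ n) <= mul_image B (p ^ m)}.
Proof.
move=> mn _ /asboolP[y yB ->]; apply/asboolP; exists (y *+ p ^ (n - m)).
  exact: rpredMn.
by rewrite -mulrnA -expnD subnK.
Qed.

Lemma mul_image_sub (V : zmodType) (B : zmodClosed V) n :
  {subset mul_image B n <= B}.
Proof. by move=> _ /asboolP[y yB ->]; exact: rpredMn. Qed.

Lemma dual_filtration_lt i j : olt (sval i.1) (sval j.1) ->
  {subset dual_filtration j <= dual_filtration (ulm_next i)}.
Proof. by move=> ij chi /mul_image_sub; exact: annihilator_series_lt. Qed.

Lemma dual_filtration_oeq i j : oeq (sval i.1) (sval j.1) -> (j.2 <= i.2)%N ->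
  {subset dual_filtration i <= dual_filtration j}.
Proof.
by rewrite /dual_filtration => /torsion_series_oeq ->; exact: mul_image_leq.
Qed.

(** The least [a] at which [chi] leaves the annihilators is neither 0 nor a limit, hence a successor
    of some [b] below [t]; [chi] is then not infinitely divisible in the annihilator of [T_b], which
    fixes its finite height there. *)
Lemma dual_ulm_filtration : (forall x, x \in torsion_series G t) ->
  ulm_filtration p (@ulm_next t) dual_filtration.
Proof.
move=> Gt; split=> [[a n] chi|chi chi0].
  split=> [/asboolP[y yB ->]|[_ /asboolP[y yB ->] ->]].
    exists (y *+ p ^ n); first by apply/asboolP; exists y.
    by rewrite -mulrnA -expnSr.
  by apply/asboolP; exists y; rewrite // -mulrnA -expnSr.
pose P a : Prop := chi \notin annihilator (torsion_series G a).
have Pt : P t.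
  apply: contra chi0 => /asboolP chi0; apply/eqP/dual_eqP => x; exact: chi0.
have [a Pa amin] := olt_minimal Pt.
have at_ : ole a t by have [//|/amin] := ole_total a t.
case: (oeq_cases a) => [/torsion_series_oeq a0|[b ab]|la].
- case/negP: Pa; rewrite a0 torsion_series0; apply/asboolP => x /eqP->.
  exact: raddf0.
- have bt : olt b t by apply: olt_le_trans at_; apply: olt_le_trans ab.2;
    exists tt; exact: ole_refl.
  have /negP/negPn chib : ~ P b by apply: amin; apply: olt_le_trans ab.2;
    exists tt; exact: ole_refl.
  have ex : exists n, chi \notin mul_image (annihilator (torsion_series G b))
    (p ^ n).
    apply: contrapT => nex; case/negP: Pa; rewrite (torsion_series_oeq G ab).
    by apply/annihilator_seriesS => n; apply/negPn/negP => nchi; apply: nex;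
      exists n.
  (* The least failing exponent is positive, since exponent 0 gives the whole annihilator; its
     predecessor is the finite part of the height. *)
  have [[|n] chin nmin] := ex_minnP ex.
    by case/negP: chin; apply/asboolP; exists chi; rewrite ?mulr1n.
  exists (exist _ b bt, n); last exact: chin.
  by apply/negPn/negP => /nmin; rewrite ltnn.
case/negP: Pa; apply: annihilator_torsion_series_lim => // b /amin.
by move=> /negP/negPn.
Qed.

End DualFiltration.

Lemma dual_filtrations_compatible (p : nat) (G H : topologicalZmodType) t :
  prime p -> pro_p p G -> pro_p p H ->
  compatible_filtrations (@ulm_next t) (@dual_filtration p G t)
    (@dual_filtration p H t).
Proof.
move=> p_pr Gp Hp i j.
have [ij|ji] := ole_total (sval i.1) (sval j.1); last first.
  left; split=> chi chii.
    have := @dual_filtration_lt p G t p_pr Gp j i ji chi chii.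
    exact: (@dual_filtration_oeq p G t (ulm_next j) j (conj (ole_refl _)
      (ole_refl _)) (leqnSn _)).
  have := @dual_filtration_lt p H t p_pr Hp j i ji chi chii.
  exact: (@dual_filtration_oeq p H t (ulm_next j) j (conj (ole_refl _)
    (ole_refl _)) (leqnSn _)).
have [ji|ij'] := ole_total (sval j.1) (sval i.1); last first.
  by right; split; exact: dual_filtration_lt.
have [le|lt] := leqP j.2 i.2.
  by left; split; apply: dual_filtration_oeq.
by right; split; apply: dual_filtration_oeq.
Qed.

(** * Transport of characters along an isomorphism of torsion factors *)

Section Transport.
Variables (G H : topologicalZmodType).
Variables (S K : zmodClosed G) (S' K' : zmodClosed H).

Local Notation proj := (quotient_map (preimage_subgroup (val : subgroup S ->
  G) K)).
Local Notation proj' := (quotient_map (preimage_subgroup (val : subgroup S' ->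
  H) K')).

Variable f : {additive quotient_group (preimage_subgroup (val : subgroup S ->
  G) K) ->
  quotient_group (preimage_subgroup (val : subgroup S' -> H) K')}.
Variable g : quotient_group (preimage_subgroup (val : subgroup S' -> H) K') ->
  quotient_group (preimage_subgroup (val : subgroup S -> G) K).
Hypotheses (fK : cancel f g) (gK : cancel g f) (g_cont : continuous g).

(** Only the restrictions to [S] and [S'] are compared, so partners are determined modulo the
    annihilators of [S] and [S']: this is a relation between whole character groups inducing a map
    of quotients. *)
Definition corresponding : {pred (dual G * dual H)%type} :=
  [pred e | `[< forall (u : subgroup S) (v : subgroup S'),
     f (proj u) = proj' v -> dual_fun e.1 (val u) = dual_fun e.2 (val v) >] ].
Lemma corresponding_closed : zmod_closed corresponding.
Proof.
split=> [|c d /asboolP cP /asboolP dP]; apply/asboolP => // u v uv.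
by rewrite !dualBE (cP u v) // (dP u v).
Qed.
HB.instance Definition _ :=
  GRing.isZmodClosed.Build (dual G * dual H)%type corresponding
    corresponding_closed.

Section TransportGraph.
Variables (U : zmodClosed H) (chi : dual G).
Definition transport_graph : {pred (H * QZ)%type} :=
  [pred e | `[< exists (u : subgroup S) (v : subgroup S'),
     [/\ f (proj u) = proj' v, e.1 - val v \in U & e.2 = chi (val u)] >] ].
Lemma transport_graph_closed : zmod_closed transport_graph.
Proof.
split=> [|c d /asboolP[u [v [uv cU cE]]] /asboolP[u' [v' [uv' dU dE]]]];
  apply/asboolP.
  by exists 0, 0; split; rewrite ?raddf0 ?addr0 ?rpred0.
exists (u - u'), (v - v'); split; first by rewrite !raddfB /= uv uv'.
  by rewrite raddfB subrB_interchange rpredB.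
by rewrite !raddfB /= cE dE.
Qed.
HB.instance Definition _ :=
  GRing.isZmodClosed.Build (H * QZ)%type transport_graph transport_graph_closed.
End TransportGraph.

(** A character killing [K] descends to the quotient of [S], moves through [g] to a continuous
    character of [S'], and extends to [H]. *)
Lemma transport_character p (chi : dual G) : prime p -> pro_p p H ->
    {subset K' <= S'} -> chi \in annihilator K ->
  exists2 psi, psi \in annihilator K' & (chi, psi) \in corresponding.
Proof.
move=> p_pr Hp KS /asboolP chiK.
have fiber u u' : proj u = proj u' -> chi (val u) = chi (val u').
  move=> /quotient_map_eqP /chiK; rewrite !raddfB /= => /eqP.
  by rewrite subr_eq0 => /eqP.
pose N := [set v | exists2 u, chi (val u) = 0 & f (proj u) = proj' v].
have [B oB BN] : exists2 B : set H, open B & [set v :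
  subgroup S' | B (val v)] = N.
  have cval : continuous (val : subgroup S -> G).
    exact: (@initial_continuous {x : G | x \in S} G val).
  have oker : open [set u : subgroup S | chi (val u) = 0].
    apply: (@open_comp _ _ (val : subgroup S ->
      G) [set x | chi x = 0]) => [u _|].
      exact: cval.
    exact: (@dual_preimage_open G chi [set 0]).
  have : open N.
    rewrite (_ : N = (g \o proj') @^-1` (proj @` [set u | chi (val u) = 0])).
      apply: open_comp; last exact: quotient_map_open.
      move=> v _; apply: continuous_comp; last exact: g_cont.
      exact: quotient_map_continuous.
    apply/seteqP; split=> [v [u cu uv]|v [u cu uv]]; exists u => //=.
      by rewrite -uv fK.
    by rewrite uv /= gK.
  by case=> B oB BN; exists B.
(* [U] meets [S'] only inside the kernel [N] of the transported character, so prescribing 0 on [U]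
   is consistent and [dual_extension] applies. *)
have [U [oU UB]] : exists U : zmodClosed H, open [set` U] /\ [set` U] `<=` B.
  apply: (open_subgroup_basis Hp.1); apply: open_nbhs_nbhs; split=> //.
  suff : N 0 by rewrite -BN.
  by exists 0; rewrite !raddf0.
have [d /asboolP[u [v [uv /= vU ->]]]|u uU|psi psiE] :=
    dual_extension p_pr Hp (R := transport_graph U chi) oU.
- have : N v by rewrite -BN /=; apply: UB; rewrite /= -rpredN -sub0r.
  move=> [u' chiu' uv']; rewrite (fiber u u') //.
  by apply: (can_inj fK); rewrite uv uv'.
- by apply/asboolP; exists 0, 0; split; rewrite ?raddf0 ?oppr0 ?addr0.
have psi_val u v : f (proj u) = proj' v -> psi (val v) = chi (val u).
  by move=> uv; apply: psiE; apply/asboolP; exists u, v; rewrite subrr rpred0.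
exists psi; last by apply/asboolP => u v /psi_val.
apply/asboolP => x xK; pose v : subgroup S' := Sub x (KS x xK).
have vx : val v = x by rewrite SubK.
rewrite -vx (psi_val 0 v) ?raddf0 //.
rewrite -(raddf0 proj'); apply/quotient_map_eqP.
by rewrite sub0r rpredN; have : val v \in K' by rewrite vx.
Qed.

Lemma corresponding_annihilator chi psi : (chi, psi) \in corresponding ->
  (chi \in annihilator S) = (psi \in annihilator S').
Proof.
move=> /asboolP cP; apply/asboolP/asboolP => c0 x xS.
  have [u uv] := quotient_map_surj (g (proj' (Sub x xS : subgroup S'))).
  have := cP u (Sub x xS); rewrite uv gK SubK => /(_ erefl) /= <-.
  exact/c0/valP.
have [v vu] := quotient_map_surj (f (proj (Sub x xS : subgroup S))).
have := cP (Sub x xS) v; rewrite vu SubK => /(_ erefl) /= ->.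
exact/c0/valP.
Qed.
End Transport.

Lemma topologically_isomorphic_sym (G H : topologicalZmodType) :
  topologically_isomorphic G H -> topologically_isomorphic H G.
Proof.
move=> [f [g [fK gK fC gC]]].
have gB : zmod_morphism g.
  by move=> x y; apply: (can_inj fK); rewrite raddfB /= !gK.
pose gA : {additive H -> G} := HB.pack g (GRing.isZmodMorphism.Build _ _ g gB).
by exists gA, f.
Qed.

Lemma dual_invariants_le (p : nat) (G H : topologicalZmodType) t :
  prime p -> pro_p p G -> pro_p p H ->
  (forall a, olt a t -> topologically_isomorphic (torsion_factor G a)
    (torsion_factor H a)) ->
  invariants_le p (@ulm_next t) (@dual_filtration p G t)
    (@dual_filtration p H t).
Proof.
move=> p_pr Gp Hp GH [[a at_] n] m v [vF vI].
have [f [g [fK gK fC gC]]] := GH a at_.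
have sub X x : x \in torsion_series X a -> x \in torsion_series X (osucc a).
  by rewrite torsion_seriesS; exact: torsion_step_sub.
have aS : olt a (osucc a) by exists tt; exact: ole_refl.
apply: (@socle_transfer p _ _ (annihilator (torsion_series G a))
  (annihilator (torsion_series G (osucc a))) (annihilator (torsion_series H a))
  (annihilator (torsion_series H (osucc a))) (corresponding f) n m v) => //.
- by move=> chi; apply: (transport_character fK gK gC p_pr Hp) => x; exact: sub.
- have gB : zmod_morphism g by move=> x y; apply: (can_inj fK);
    rewrite raddfB /= !gK.
  pose gA : {additive torsion_factor H a -> torsion_factor G a} :=
    HB.pack g (GRing.isZmodMorphism.Build _ _ g gB).
  move=> psi psiK; have [x|chi chiK /asboolP chipsi] :=
    @transport_character H G _ _ _ _ gA f gK fK fC p psi p_pr Gp _ psiK.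
    exact: sub.
  exists chi => //; apply/asboolP => u w uw; apply/esym/chipsi.
  by rewrite /= -uw fK.
- by move=> chi psi; exact: (corresponding_annihilator gK).
- by move=> k chi; exact: annihilator_series_lt.
- by move=> k chi; exact: annihilator_series_lt.
Qed.

Theorem theorem1p8 (p : nat) (G H : topologicalZmodType) :
  prime p ->
  countably_based G -> pro_p p G -> dual_reduced G ->
  countably_based H -> pro_p p H -> dual_reduced H ->
  same_torsion_sequence G H ->
  topologically_isomorphic G H.
Proof.
move=> p_pr cG Gp rG cH Hp rH [t [tG tH GH]].
have HG a : olt a t -> topologically_isomorphic (torsion_factor H a)
  (torsion_factor G a).
  by move=> /GH/topologically_isomorphic_sym.
have [[_ hG _] _] := Gp; have [[_ hH _] _] := Hp.
have [a aP] := dual_enumeration Gp cG; have [b bP] := dual_enumeration Hp cH.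
have [K [KG KH K0]] := ulm_correspondence p_pr aP bP (dual_primary Gp)
  (dual_primary Hp)
  (dual_ulm_filtration p_pr Gp (dual_reduced_torsion_type hG rG tG))
  (dual_ulm_filtration p_pr Hp (dual_reduced_torsion_type hH rH tH))
  (dual_filtrations_compatible (t := t) p_pr Gp Hp)
  (dual_invariants_le p_pr Gp Hp GH) (dual_invariants_le p_pr Hp Gp HG).
exact: topologically_isomorphic_dual p_pr Gp Hp KG KH K0.
Qed.
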